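(* Let $\{(U_{k,i}, V_{k,i}); i \geq 1, k \geq 1\}$ be an array of i.i.d. two-dimensional random vectors and let $\{p_n; n \geq 1\}$ be a sequence of positive integers (not necessarily monotone) such that $n/p_n$ is bounded away from $0$ and $\infty$. Let $$T_n = \max_{1 \leq i \neq j \leq p_n} \Big| \sum_{k=1}^n U_{k,i} V_{k,j} \Big|, \quad n \geq 1.$$ Let $\alpha > 1/2$. Then $$\lim_{n \to \infty} \frac{T_n}{n^\alpha} = 0 \quad \text{a.s.}$$ if and only if $$\sum_{n=1}^{\infty} P\Big(\max_{1 \leq i \neq j \leq n} |U_{1,i} V_{1,j}| \geq n^\alpha\Big) < \infty$$ and, in the case $\alpha \leq 1$, additionally $(EU_{1,1})(EV_{1,1}) = 0$. *)

(* Defs.v *)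
From HB Require Import structures.
From mathcomp Require Import all_boot all_order all_algebra.
From mathcomp Require Import all_classical all_reals all_analysis.
Set Implicit Arguments. Unset Strict Implicit. Unset Printing Implicit Defensive.
Import Order.TTheory GRing.Theory Num.Theory.
Import numFieldNormedType.Exports.
Local Open Scope classical_set_scope.
Local Open Scope ring_scope.

Definition mutually_independent_pairs {d} {T : measurableType d} {R : realType}
  (P : probability T R) (I : eqType) (X : I -> T -> (R * R)%type) : Prop :=
  forall (S : seq I) (B : I -> set (R * R)%type),
    uniq S -> (forall i, measurable (B i)) ->
    P (\bigcap_(i in [set i | i \in S]) (X i @^-1` B i)) =
    (\prod_(i <- S) P (X i @^-1` B i))%E.

Definition identically_distributed_pairs {d} {T : measurableType d} {R : realType}
  (P : probability T R) (I : Type) (X : I -> T -> (R * R)%type) : Prop :=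
  forall (i j : I) (B : set (R * R)%type), measurable B ->
    P (X i @^-1` B) = P (X j @^-1` B).

(* max over 1 <= i <> j <= p (indices shifted to 0 <= i <> j < p) of
   |sum_{k=1}^n U_{k,i} V_{k,j}|;  the empty max is 0. *)
Definition Tstat {T : Type} {R : realType} (U V : nat -> nat -> T -> R)
  (p n : nat) (t : T) : R :=
  \big[Num.max/0]_(i < p) \big[Num.max/0]_(j < p | i != j)
     `| \sum_(k < n) U k i t * V k j t |.

Definition Mstat {T : Type} {R : realType} (U V : nat -> nat -> T -> R)
  (n : nat) (t : T) : R :=
  \big[Num.max/0]_(i < n) \big[Num.max/0]_(j < n | i != j) `| U 0 i t * V 0 j t |.

(* Main.v *)
(** Let Z = U_{1,1} V_{1,2}, let Q(m, x) (rowmax_tail) be the probability that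
    a row of m columns contains some i <> j with |U_i V_j| >= x, let (C) be the
    summability of Q(n, n^alpha), let S_n stand for the n-th sum of a pair i <> j,
    and let K bound p_n/n.

    Necessity of (C).  The n-th row is the difference of two consecutive sums, so
    T_n = o(n^alpha) forces max |U_{n,i} V_{n,j}| < n^alpha eventually, over
    i <> j <= min (p_n, p_{n-1}); rows are independent and the second
    Borel-Cantelli lemma applies.  Passing between min (p_n, p_{n-1}) and n
    columns costs a constant factor: cut the columns into boundedly many blocks;
    any two columns lie in a union of two blocks.

    Consequences of (C).  A row of n columns contains n/2 independent copies of Z,
    so (C) makes n P(|Z| >= n^alpha) summable, that is, E |Z|^(2/alpha) < oo.
    Fix s with 1 < alpha s <= 2, namely s = 2 if alpha <= 1, and
    s = min (1, 2/alpha) otherwise.  Truncate the products at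
    b = delta n^alpha.  The moment of order s and Chernoff's bound with parameter
    (eta ln n)/b give deviations of order eps n^alpha of the truncated sums
    probability O(n^-4), which survives the union bound over p_n^2 pairs, and
    summing over n needs no maximal inequality.  The truncation is eventually
    void: group n dyadically; the probability that one of the 2^(m+1) first rows
    has an entry above delta 2^(m alpha) among K 2^(m+1) columns is, by the block
    argument, O(sum of Q(n, n^alpha) over a dyadic block).  Hence
    max |S_n - n mu| = o(n^alpha) a.s., with mu = E Z if alpha <= 1 and mu = 0
    otherwise; this gives sufficiency, and necessity of E Z = 0 as well. *)

Require Import Defs.
From HB Require Import structures.
From mathcomp Require Import all_boot all_order all_algebra.
From mathcomp Require Import all_classical all_reals all_analysis.
From mathcomp Require Import measurable_realfun.
From mathcomp Require Import ring lra zify.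
Import Order.TTheory GRing.Theory Num.Theory.
Import numFieldNormedType.Exports.
Local Open Scope classical_set_scope.
Local Open Scope ring_scope.

Set Implicit Arguments. Unset Strict Implicit. Unset Printing Implicit Defensive.

(** * Independence of families and of blocks *)

Section independence.
Context {d} {T : measurableType d} {R : realType} (P : probability T R).

(** The value space is arbitrary, so that one notion serves the pairs [(U, V)], the products and the
    row maxima. *)
Definition independent {d'} {V : measurableType d'} {I : eqType}
    (X : I -> T -> V) := forall (S : seq I) (B : I -> set V),
  uniq S -> (forall i, measurable (B i)) ->
  P [set t | forall i, i \in S -> B i (X i t)] =
  (\prod_(i <- S) P (X i @^-1` B i))%E.

Lemma independent_pair {d'} {V : measurableType d'} {I : eqType}
    (X : I -> T -> V) (i j : I) (A B : set V) : independent X -> i != j ->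
  measurable A -> measurable B ->
  P (X i @^-1` A `&` X j @^-1` B) = (P (X i @^-1` A) * P (X j @^-1` B))%E.
Proof.
move=> iX ij mA mB.
have := iX [:: i; j] (fun k => if k == i then A else B).
rewrite /= inE ij big_cons big_seq1 eqxx eq_sym (negbTE ij) => <- //.
- congr (P _); apply/seteqP; split => [t [Ai Bj] k|t h].
    by rewrite !inE => /orP[]/eqP ->; rewrite ?eqxx// eq_sym (negbTE ij).
  have := h i; have := h j; rewrite !inE !eqxx orbT/= eq_sym (negbTE ij).
  by move=> /(_ isT) ? /(_ isT).
- by move=> k; case: ifP.
Qed.

Lemma independent_inj {d'} {V : measurableType d'} {I J : eqType}
    (X : I -> T -> V) (s : J -> I) : injective s -> independent X ->
  independent (fun j => X (s j)).
Proof.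
move=> sI iX S B uS mB; case: S uS => [_|j0 S' uS].
  rewrite big_nil -(@probability_setT _ _ _ P); congr (P _).
  by apply/seteqP; split.
(* [C] transports [B] along [s] without an inverse of [s]: an index is looked up in [map s S].
   Outside that list the default [j0] is returned, which is harmless since only members are
   tested. *)
set S := j0 :: S'; pose C i := B (nth j0 S (index i (map s S))).
have CE j : j \in S -> C (s j) = B j.
  by move=> jS; rewrite /C index_map// nth_index.
have := iX (map s S) C; rewrite map_inj_uniq// => /(_ uS) iXS.
rewrite -[LHS](_ : P [set t | forall i, i \in map s S -> C i (X i t)] = _).
  rewrite iXS; last by move=> i; exact: mB.
  rewrite big_map big_seq [RHS]big_seq; apply: eq_bigr => j jS.
  by rewrite CE.
congr (P _); apply/seteqP; split => [t h j jS|t h i /mapP[j jS ->]].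
  by rewrite -CE//; apply: h; exact: map_f.
by rewrite CE//; exact: h.
Qed.

Lemma measurable_all_in {d'} {V : measurableType d'} {I : eqType}
    (X : I -> T -> V) (S : seq I) (B : I -> set V) :
  (forall i, measurable_fun setT (X i)) -> (forall i, measurable (B i)) ->
  measurable [set t | forall i, i \in S -> B i (X i t)].
Proof.
move=> mX mB; elim: S => [|i S IH].
  by rewrite (_ : mkset _ = setT)//; apply/seteqP; split.
rewrite (_ : mkset _ =
    X i @^-1` B i `&` [set t | forall i, i \in S -> B i (X i t)]).
  by apply: measurableI => //; rewrite -[X in measurable X]setTI; exact: mX.
apply/seteqP; split => [t h|t [h1 h2] j].
  by split=> [|j jS]; apply: h; rewrite in_cons ?eqxx// jS orbT.
by rewrite in_cons => /orP[/eqP ->//|/h2].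
Qed.

End independence.

(** * Path space with the sigma-algebra of cylinders, and joint laws *)

Definition cylinder (I : eqType) {d'} (V : measurableType d') :
    set (set (I -> V)) :=
  [set C | exists S A, [/\ uniq S, (forall i, measurable (A i)) &
     C = [set w | forall i, i \in S -> A i (w i)]]].

Arguments cylinder I {d'} V.

Notation path_space I V := (g_sigma_algebraType (cylinder I V)).

Section path_space.
Context {I : eqType} {d'} {V : measurableType d'}.

Lemma measurable_path_coord (i : I) :
  measurable_fun setT (fun w : path_space I V => w i).
Proof.
move=> _ B mB; rewrite setTI; apply: sub_sigma_algebra.
exists [:: i], (fun=> B); split => //.
by apply/seteqP; split=> [w Bi j /[!inE] /eqP ->//|w]; apply; rewrite inE.
Qed.

Lemma cylinder_setT : cylinder I V setT.
Proof.
by exists [::], (fun=> setT); split => //; apply/seteqP; split.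
Qed.

Lemma cylinder_setI : setI_closed (cylinder I V).
Proof.
move=> _ _ [S1 [A1 [u1 m1 ->]]] [S2 [A2 [u2 m2 ->]]].
exists (undup (S1 ++ S2)), (fun i => (if i \in S1 then A1 i else setT) `&`
  (if i \in S2 then A2 i else setT)); split.
- exact: undup_uniq.
- by move=> i; apply: measurableI; case: ifP.
- apply/seteqP; split => [w [h1 h2] i|w h].
    rewrite mem_undup mem_cat => _; split; case: ifPn => //.
      by move/h1.
    by move/h2.
  split=> i iS; have := h i; rewrite mem_undup mem_cat iS ?orbT.
    by move=> /(_ isT)[].
  by move=> /(_ isT)[].
Qed.

Context {d} {T : measurableType d} {R : realType} (P : probability T R).


Lemma measurable_joint (X : I -> T -> V) :
  (forall i, measurable_fun setT (X i)) ->
  measurable_fun setT ((fun t => X^~ t) : T -> path_space I V).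
Proof.
move=> mX; apply: (@measurability _ _ _ (path_space I V) _ _ (cylinder I V)) => //.
move=> _ [_ [S [A [_ mA ->]]] <-].
by rewrite setTI; exact: measurable_all_in.
Qed.

Lemma measurable_path_preimage (X : I -> T -> V) (E : set (path_space I V)) :
  (forall i, measurable_fun setT (X i)) -> measurable E ->
  measurable [set t | E (X^~ t)].
Proof.
move=> mX mE; rewrite -[X in measurable X]setTI.
have := measurable_joint mX; move=> /(_ measurableT E mE); exact.
Qed.
End path_space.

(** Cylinders form a generating class stable under intersection, so the two pushforwards to path
    space coincide. Measures are allowed, and not only probabilities, because [independent_path]
    compares a restriction of [P] with a multiple of [P]. *)
Lemma path_measure_unique {I : eqType} {d'} {V : measurableType d'} {R : realType}
    {d1 d2} {T1 : measurableType d1} {T2 : measurableType d2}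
    (m1 : {measure set T1 -> \bar R}) (m2 : {measure set T2 -> \bar R})
    (X : I -> T1 -> V) (Y : I -> T2 -> V) :
  (m1 setT < +oo)%E ->
  (forall i, measurable_fun setT (X i)) ->
  (forall i, measurable_fun setT (Y i)) ->
  (forall C, cylinder I V C ->
    m1 [set t | C (X^~ t)] = m2 [set t | C (Y^~ t)]) ->
  forall E : set (path_space I V), measurable E ->
  m1 [set t | E (X^~ t)] = m2 [set t | E (Y^~ t)].
Proof.
move=> m1oo mX mY m12 E mE.
pose n1 := measure_function_pushforward__canonical__measure_function_Measure m1
  (measurable_joint mX).
pose n2 := measure_function_pushforward__canonical__measure_function_Measure m2
  (measurable_joint mY).
have cT : \bigcup_(k : nat) (setT : set (path_space I V)) = setT.
  by rewrite bigcup_const//; exists 0%N.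
exact: (@measure_unique _ R (path_space I V) (cylinder I V) (fun=> setT) erefl
  cylinder_setI (fun=> cylinder_setT) cT n1 n2 m12 (fun=> m1oo) E mE).
Qed.

Section joint_law.
Context {d} {T : measurableType d} {R : realType} (P : probability T R).
Context {d'} {V : measurableType d'}.

(** On a cylinder independence factors both sides into equal marginals. This lets any selection of
    distinct entries be replaced by a reference one. *)
Lemma eq_joint_law {I : eqType} (X Y : I -> T -> V) :
  (forall i, measurable_fun setT (X i)) ->
  (forall i, measurable_fun setT (Y i)) ->
  independent P X -> independent P Y ->
  (forall i B, measurable B -> P (X i @^-1` B) = P (Y i @^-1` B)) ->
  forall E : set (path_space I V), measurable E ->
  P [set t | E (X^~ t)] = P [set t | E (Y^~ t)].
Proof.
move=> mX mY iX iY XY; apply: (path_measure_unique (m1 := P) (m2 := P)) => //.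
  by rewrite /= probability_setT ltry.
move=> _ [S [A [uS mA ->]]].
rewrite [LHS](iX S A uS mA) [RHS](iY S A uS mA).
by apply: eq_bigr => i _; exact: XY.
Qed.

(** For fixed [B] both sides are finite measures in [E]: [P] restricted to [B], and [P] scaled by
    the mass of [B]. Agreement on cylinders is therefore enough. *)
Lemma independent_path {I : eqType} (X : I -> T -> V) (B : set T) :
  (forall i, measurable_fun setT (X i)) -> measurable B ->
  (forall C, cylinder I V C ->
    P ([set t | C (X^~ t)] `&` B) = (P [set t | C (X^~ t)] * P B)%E) ->
  forall E : set (path_space I V), measurable E ->
  P ([set t | E (X^~ t)] `&` B) = (P [set t | E (X^~ t)] * P B)%E.
Proof.
move=> mX mB h E mE; have PB0 : 0 <= fine (P B) by exact: fine_ge0.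
rewrite muleC -[P B]fineK ?fin_num_measure//.
apply: (path_measure_unique (m1 := mrestr P mB) (m2 := mscale (NngNum PB0) P)) => //.
  by rewrite /= /mrestr setTI ltey_eq fin_num_measure.
by move=> C cC; rewrite /= /mrestr /mscale/= h// muleC fineK ?fin_num_measure.
Qed.

(* The blocks are turned one at a time from cylinders into arbitrary events. *)
Lemma independent_blocks {J I : eqType} (X : J * I -> T -> V)
    {d''} {W : measurableType d''} (f : J -> path_space I V -> W) :
  (forall i, measurable_fun setT (X i)) -> (forall j, measurable_fun setT (f j)) ->
  independent P X ->
  independent P (fun j t => f j (fun i => X (j, i) t)).
Proof.
move=> mX mf iX S D uS mD.
pose E j : set (path_space I V) := f j @^-1` D j.
have mE j : measurable (E j) by rewrite -[E j]setTI; exact: mf.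
have mXE j : measurable [set t | E j (fun i => X (j, i) t)].
  exact: (@measurable_path_preimage _ _ _ _ _ (fun i => X (j, i))).
(* Invariant of the induction: the blocks in [s] already carry arbitrary events, while the
   coordinates in [U], all from other blocks, still carry conditions of cylinder type. *)
suff H (s : seq J) (U : seq (J * I)) (B : J * I -> set V) :
    uniq s -> uniq U -> (forall x, x \in U -> x.1 \notin s) ->
    (forall i, measurable (B i)) ->
  P ([set t | forall j, j \in s -> E j (fun i => X (j, i) t)] `&`
     [set t | forall x, x \in U -> B x (X x t)]) =
  (\prod_(j <- s) P [set t | E j (fun i => X (j, i) t)] *
   \prod_(x <- U) P (X x @^-1` B x))%E.
  have := H S [::] (fun=> setT) uS isT.
  rewrite big_nil mule1 => <- //.
  by congr (P _); apply/seteqP; split => [t h|t []].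
elim: s U B => [|j s IH] U B.
  move=> _ uU _ mB; rewrite big_nil mul1e -iX//; congr (P _).
  by apply/seteqP; split => [t []|].
move=> /= /andP[js us] uU Us mB.
set G := [set t | forall j, j \in s -> E j (fun i => X (j, i) t)] `&`
     [set t | forall x, x \in U -> B x (X x t)].
have mG : measurable G.
  apply: measurableI; last exact: measurable_all_in.
  elim: (s) => [|i S' IH'].
    by rewrite (_ : mkset _ = setT)//; apply/seteqP; split.
  rewrite (_ : mkset _ = [set t | E i (fun i' => X (i, i') t)] `&`
     [set t | forall j, j \in S' -> E j (fun i => X (j, i) t)]).
    exact: measurableI.
  apply/seteqP; split => [t h|t [h1 h2] k].
    by split=> [|k kS]; apply: h; rewrite in_cons ?eqxx// kS orbT.
  by rewrite in_cons => /orP[/eqP ->//|/h2].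
have UsE x : x \in U -> x.1 \notin s /\ x.1 != j.
  by move=> /Us; rewrite in_cons negb_or => /andP[].
have PG : P G = (\prod_(j <- s) P [set t | E j (fun i => X (j, i) t)] *
   \prod_(x <- U) P (X x @^-1` B x))%E.
  by apply: IH => // x /UsE[].
rewrite (_ : _ `&` _ = [set t | E j (fun i => X (j, i) t)] `&` G); last first.
  apply/seteqP; split => [t [h1 h2]|t [h1 [h2 h3]]].
    split; first by apply: h1; rewrite in_cons eqxx.
    by split=> // k ks; apply: h1; rewrite in_cons ks orbT.
  by split => // k; rewrite in_cons => /orP[/eqP ->//|]; exact: h2.
(* It remains to treat a cylinder in block [j]. Its coordinates are merged into the list [U],
   through [B'], and the induction hypothesis for [s] applies. *)
rewrite (independent_path (X := fun i => X (j, i)))// ?PG ?big_cons ?muleA//.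
move=> _ [S' [A [uS' mA ->]]].
pose B' x := if x.1 == j then A x.2 else B x.
have mB' x : measurable (B' x) by rewrite /B'; case: ifP.
have jI : injective (pair j : I -> J * I) by move=> ? ? [].
have uS'U : uniq (map (pair j) S' ++ U).
  rewrite cat_uniq map_inj_uniq// uS' uU andbT /= -all_predC.
  apply/allP => x /UsE[_ xj]; apply/negP => /mapP[i _ xE].
  by move: xj; rewrite xE eqxx.
have B'U x : x \in U -> B' x = B x by move=> /UsE[_ /negbTE]; rewrite /B' => ->.
transitivity (P ([set t | forall j, j \in s -> E j (fun i => X (j, i) t)] `&`
     [set t | forall x, x \in map (pair j) S' ++ U -> B' x (X x t)])).
  congr (P _); apply/seteqP; split => [t [h1 [h2 h3]]|t [h1 h2]].
    split => // x; rewrite mem_cat => /orP[/mapP[i iS ->]|xU].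
      by rewrite /B'/= eqxx; exact: h1.
    by rewrite B'U//; exact: h3.
  split=> [i iS|].
    have := h2 (j, i); rewrite /B'/= eqxx; apply.
    by rewrite mem_cat map_f.
  by split => // x xU; rewrite -B'U//; apply: h2; rewrite mem_cat xU orbT.
rewrite IH//; last first.
  by move=> x; rewrite mem_cat => /orP[/mapP[i _ ->]//|/UsE[]].
rewrite big_cat/= big_map.
have -> : (\prod_(x <- U) P (X x @^-1` B' x) = \prod_(x <- U) P (X x @^-1` B x))%E.
  by rewrite big_seq [RHS]big_seq; apply: eq_bigr => x xU; rewrite B'U.
have -> : (\prod_(i <- S') P (X (j, i) @^-1` B' (j, i)) =
  P [set t | forall i, i \in S' -> A i (X (j, i) t)])%E.
  have := independent_inj jI iX; rewrite /independent => ->//.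
  by apply: eq_bigr => i _; rewrite /B'/= eqxx.
by rewrite muleCA.
Qed.

End joint_law.

(** * Products of independent variables, Chernoff bound *)

Lemma measurable_ge_set {d} {T : measurableType d} {R : realType} (f : T -> R)
  (a : R) : measurable_fun setT f -> measurable [set t | a <= f t].
Proof.
move=> mf; set A := [set t | _]; rewrite -[A]setTI.
have := mf measurableT `[a, +oo[%classic.
rewrite (_ : _ @^-1` _ = A); first by apply; exact: measurable_itv.
by apply/seteqP; split => t /=; rewrite in_itv/= andbT.
Qed.

Section product_expectation.
Context {d} {T : measurableType d} {R : realType} (P : probability T R).
Local Open Scope ereal_scope.

Definition independent2 {d1 d2} {T1 : measurableType d1} {T2 : measurableType d2}
    (F : T -> T1) (G : T -> T2) := forall (A : set T1) (B : set T2),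
  measurable A -> measurable B ->
  P (F @^-1` A `&` G @^-1` B) = P (F @^-1` A) * P (G @^-1` B).

(** Independence says that the joint law agrees with the product measure on rectangles, hence
    everywhere; Tonelli's theorem then gives the iterated integral. *)
Lemma ge0_integral_joint {d1 d2} {T1 : measurableType d1} {T2 : measurableType d2}
    (F : {mfun T >-> T1}) (G : {mfun T >-> T2}) (f : T1 * T2 -> \bar R) :
  independent2 F G -> measurable_fun [set: T1 * T2] f -> (forall z, 0 <= f z) ->
  \int[P]_t f (F t, G t) =
  \int[distribution P F]_x \int[distribution P G]_y f (x, y).
Proof.
move=> iFG mf f0.
have mFG : measurable_fun setT (fun t => (F t, G t)).
  exact: measurable_fun_pair.
transitivity (\int[pushforward P (fun t => (F t, G t))]_z f z).
  by rewrite ge0_integral_pushforward.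
rewrite -(fubini_tonelli1 (m1 := distribution P F) (m2 := distribution P G))//.
pose m' := measure_function_pushforward__canonical__measure_function_Measure P mFG.
apply/esym.
apply: (@eq_measure_integral _ _ _ _ m') => A mA _.
by apply: (product_measure_unique (m' := m')) => // B C mB mC; exact: iFG.
Qed.

Lemma ge0_integralM_independent (F G : T -> R) :
  measurable_fun setT F -> measurable_fun setT G ->
  (forall t, 0 <= F t)%R -> (forall t, 0 <= G t)%R -> independent2 F G ->
  \int[P]_t (F t * G t)%:E = \int[P]_t (F t)%:E * \int[P]_t (G t)%:E.
Proof.
move=> mF mG F0 G0 iFG.
pose F' : {mfun T >-> R} := HB.pack F (isMeasurableFun.Build _ _ _ _ _ mF).
pose G' : {mfun T >-> R} := HB.pack G (isMeasurableFun.Build _ _ _ _ _ mG).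
(* The absolute values make the integrand nonnegative on the whole plane and change nothing on the
   range of [F] and [G]. *)
have := @ge0_integral_joint _ _ _ _ F' G' (fun z => (`|z.1| * `|z.2|)%:E) iFG.
rewrite [X in (_ -> _ -> X = _) -> _](_ : _ = \int[P]_t (F t * G t)%:E); last first.
  by apply: eq_integral => t _ /=; rewrite !ger0_norm.
have mabs : measurable_fun setT (fun y : R => `|y|%:E).
  by apply/measurable_EFinP; exact: normr_measurable.
have EF : \int[distribution P F']_x `|x|%:E = \int[P]_t (F t)%:E.
  rewrite ge0_integral_distribution//.
  by apply: eq_integral => t _ /=; rewrite ger0_norm.
have EG : \int[distribution P G']_x `|x|%:E = \int[P]_t (G t)%:E.
  rewrite ge0_integral_distribution//.
  by apply: eq_integral => t _ /=; rewrite ger0_norm.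
move=> -> //; last first.
  - apply/measurable_EFinP; apply: measurable_funM.
      by apply: measurableT_comp; [exact: normr_measurable|exact: measurable_fst].
    by apply: measurableT_comp; [exact: normr_measurable|exact: measurable_snd].
have inner (x : R) : \int[distribution P G']_y (`|(x, y).1| * `|(x, y).2|)%:E =
    `|x|%:E * \int[P]_t (G t)%:E.
  by rewrite -EG -ge0_integralZl.
under eq_integral do rewrite inner.
rewrite ge0_integralZr//; first by rewrite EF.
by apply: integral_ge0 => t _; rewrite lee_fin.
Qed.

Lemma independent2_comp (f g : R -> R) (F G : T -> R) :
  measurable_fun setT f -> measurable_fun setT g -> independent2 F G ->
  independent2 (fun t => f (F t)) (fun t => g (G t)).
Proof.
move=> mf mg iFG A B mA mB; apply: (iFG (f @^-1` A) (g @^-1` B)).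
  by rewrite -[X in measurable X]setTI; exact: mf.
by rewrite -[X in measurable X]setTI; exact: mg.
Qed.

(** The index [None] adjoins one fresh variable to the past, indexed by [Some]. This is the
    induction step for expectations of finite products. *)
Lemma independent_past {I : eqType} {d'} {V : measurableType d'}
    (X : option I -> T -> V) (E : set (path_space I V)) (B : set V) :
  (forall i, measurable_fun setT (X i)) -> independent P X ->
  measurable E -> measurable B ->
  P ([set t | E (fun i => X (Some i) t)] `&` X None @^-1` B) =
  P [set t | E (fun i => X (Some i) t)] * P (X None @^-1` B).
Proof.
move=> mX iX mE mB.
apply: (independent_path (X := fun i => X (Some i))) => //.
  by rewrite -[X in measurable X]setTI; exact: mX.
move=> _ [S [A [uS mA ->]]].
have SI : injective (@Some I) by move=> ? ? [].
pose B' o := if o is Some i then A i else B.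
have uS' : uniq (None :: map Some S).
  by rewrite /= map_inj_uniq// uS andbT; apply/negP => /mapP[].
have := iX _ B' uS'; rewrite big_cons/= big_map.
have := independent_inj SI iX; rewrite /independent => ->//.
rewrite muleC => <-; last by case.
congr (P _); apply/seteqP; split => [t [h1 h2] i|t h].
  by rewrite in_cons => /orP[/eqP ->//|/mapP[j jS ->]]; exact: h1.
split; last by apply: (h None); rewrite in_cons eqxx.
by move=> i iS; apply: (h (Some i)); rewrite in_cons map_f// orbT.
Qed.

Lemma ge0_integral_prod_independent (Y : nat -> T -> R) n :
  (forall k, measurable_fun setT (Y k)) -> (forall k t, 0 <= Y k t)%R ->
  independent P Y ->
  \int[P]_t (\prod_(k < n) Y k t)%:E = \prod_(k < n) \int[P]_t (Y k t)%:E.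
Proof.
move=> mY Y0 iY; elim: n => [|n IH].
  under eq_integral do rewrite big_ord0.
  rewrite big_ord0 (integral_cst P measurableT 1%:E) mul1e.
  exact: probability_setT.
under eq_integral do rewrite big_ord_recr/=.
rewrite big_ord_recr/= -IH; apply: ge0_integralM_independent => //.
- by apply: measurable_prod => i _; exact: mY.
- by move=> t; apply: prodr_ge0.
move=> A B mA mB.
pose s (o : option 'I_n) : nat := if o is Some i then i else n.
have sI : injective s.
  move=> [i|] [j|]//= => [/val_inj -> //|ij|ij].
    by have := ltn_ord i; rewrite ij ltnn.
  by have := ltn_ord j; rewrite -ij ltnn.
pose E : set (path_space 'I_n R) := (fun w => \prod_(k < n) w k)%R @^-1` A.
have mE : measurable E.
  rewrite -[E]setTI.
  have : measurable_fun setT (fun w : path_space 'I_n R => \prod_(k < n) w k)%R.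
    by apply: measurable_prod => i _; exact: measurable_path_coord.
  by move=> /(_ measurableT A mA).
exact: (independent_past (X := fun o => Y (s o)) (fun=> mY _)
  (independent_inj sI iY) mE mB).
Qed.

End product_expectation.

Section chernoff_bounded.
Context {R : realType}.

(** For [y >= 0], use [expR y - 1 <= y * expR y] both as it is and multiplied by [y]. For [y < 0],
    [expR y <= 1 / (1 - y) <= 1 + y + y^2], as [(1 + y + y^2) (1 - y) = 1 - y^3]. *)
Lemma expR_quadratic_le (y : R) : expR y <= 1 + y + y ^+ 2 * expR `|y|.
Proof.
have [y0|y0] := leP 0 y.
  rewrite ger0_norm//.
  have h1 : expR y - 1 <= y * expR y.
    have := expR_ge1Dx (- y); rewrite expRN => h.
    have := ler_wpM2l (expR_ge0 y) h; rewrite mulfV ?gt_eqF ?expR_gt0//.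
    by rewrite mulrDr mulr1; lra.
  have := ler_wpM2l y0 h1; rewrite mulrA -expr2; lra.
rewrite ltr0_norm//.
have h1 : expR y <= (1 - y)^-1.
  rewrite -[y]opprK expRN opprK lef_pV2 ?posrE ?expR_gt0//; last lra.
  exact: expR_ge1Dx.
have h2 : (1 - y)^-1 <= 1 + y + y ^+ 2.
  rewrite -[leLHS]mul1r ler_pdivrMr; last lra.
  have -> : (1 + y + y ^+ 2) * (1 - y) = 1 - y ^+ 3 by ring.
  by rewrite lerBrDr gerDl exprn_odd_le0 // ltW.
apply: (le_trans h1); apply: (le_trans h2); rewrite lerD2l ler_peMr ?sqr_ge0//.
by apply: (le_trans _ (expR_ge1Dx _)); lra.
Qed.

Context {d} {T : measurableType d} (P : probability T R).

(** The quadratic bound on the exponential gives [E expR (l W) <= expR (l m + l^2 v expR (l b))];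
    these factors multiply by independence, and Markov's inequality concludes. The variables are not
    centred: [m] comes from the linear term. *)
Lemma chernoff_sum (W : nat -> T -> R) (n : nat) (b m v l x : R) :
  (forall k, measurable_fun setT (W k)) -> independent P W ->
  (forall k t, `|W k t| <= b) -> 0 <= l ->
  (forall k, \int[P]_t (W k t)%:E = m%:E)%E ->
  (forall k, \int[P]_t (W k t ^+ 2)%:E <= v%:E)%E ->
  (P [set t | (n%:R * m + x <= \sum_(k < n) W k t)%R] <=
   (expR (n%:R * l ^+ 2 * v * expR (l * b) - l * x))%:E)%E.
Proof.
move=> mW iW Wb l0 Wm Wv.
have Wint k : P.-integrable setT (EFin \o W k).
  apply: (le_integrable _ _ _ (finite_measure_integrable_cst P b measurableT)) => //.
    exact/measurable_EFinP.
  by move=> t _; rewrite /= lee_fin (le_trans (Wb k t))// ler_norm.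
have WE k : (\int[P]_t (expR (l * W k t))%:E <=
    (expR (l * m + l ^+ 2 * v * expR (l * b)))%:E)%E.
  have mW2 : measurable_fun setT (fun t => W k t ^+ 2) by exact: measurable_funX.
  have W2int : P.-integrable setT (EFin \o (fun t => W k t ^+ 2)).
    apply: (le_integrable _ _ _
      (finite_measure_integrable_cst P (b ^+ 2) measurableT)) => //.
      exact/measurable_EFinP.
    move=> t _; rewrite /= lee_fin !normrX lerXn2r ?nnegrE//.
    by rewrite (le_trans (Wb k t))// ler_norm.
  apply: (@le_trans _ _ (\int[P]_t ((1 : R)%:E + (l%:E * (W k t)%:E +
      (l ^+ 2 * expR (l * b))%:E * (W k t ^+ 2)%:E)))%E).
    apply: ge0_le_integral => //.
    - apply/measurable_EFinP; apply: measurableT_comp => //.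
      exact: measurable_funM.
    - apply: emeasurable_funD => //; apply: emeasurable_funD => //;
      by apply: measurable_funeM; exact/measurable_EFinP.
    - move=> t _; rewrite -!EFinM -!EFinD lee_fin.
      apply: (le_trans (expR_quadratic_le _)).
      rewrite -addrA lerD2l lerD2l exprMn [leRHS]mulrAC.
      apply: ler_wpM2l; first by rewrite mulr_ge0 ?sqr_ge0.
      by rewrite ler_expR normrM (ger0_norm l0) ler_wpM2l.
  have i1 : P.-integrable setT (fun t => l%:E * (W k t)%:E)%E.
    exact: (integrableZl measurableT l (Wint k)).
  have i2 : P.-integrable setT
      (fun t => (l ^+ 2 * expR (l * b))%:E * (W k t ^+ 2)%:E)%E.
    exact: (integrableZl measurableT _ W2int).
  have i0 := finite_measure_integrable_cst P 1 measurableT.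
  rewrite (integralD measurableT i0 (integrableD measurableT i1 i2)).
  rewrite (integralD measurableT i1 i2) (integralZl measurableT (Wint k)).
  rewrite (integralZl measurableT W2int) Wm.
  rewrite (_ : \int[P]_t (EFin \o cst (1%R : R)) t = 1)%E; last first.
    by rewrite (integral_cst P measurableT 1%:E) mul1e; exact: probability_setT.
  apply: (@le_trans _ _ (1 + (l * m + l ^+ 2 * expR (l * b) * v))%:E).
    rewrite !EFinD; apply: leeD => //; apply: leeD => //.
    rewrite [leRHS]EFinM; apply: lee_wpmul2l; last exact: Wv.
    by rewrite lee_fin mulr_ge0 ?sqr_ge0 ?expR_ge0.
  by rewrite lee_fin (le_trans (expR_ge1Dx _))// ler_expR mulrAC.
set A := [set t | _].
have mS : measurable_fun setT (fun t => \sum_(k < n) W k t).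
  by apply: measurable_sum => k; exact: mW.
have mA : measurable A by exact: measurable_ge_set.
rewrite -[X in P X]setIT -(integral_indic P measurableT mA).
have mE k : measurable_fun setT (fun t => expR (l * W k t)).
  by apply: measurableT_comp => //; exact: measurable_funM.
(* Markov's inequality: the indicator of [A] is at most [c] times the product of the
   exponentials. *)
pose c := expR (- l * (n%:R * m + x)).
apply: (@le_trans _ _ (\int[P]_t (c%:E * (\prod_(k < n) expR (l * W k t))%:E))%E).
  apply: ge0_le_integral => //.
  - exact/measurable_EFinP/measurable_indic.
  - apply: measurable_funeM; apply/measurable_EFinP.
    by apply: measurable_prod => i _; exact: mE.
  - move=> t _; rewrite -EFinM lee_fin -expR_sum -expRD indicE.
    have [tA|_] := boolP (t \in A); last exact: expR_ge0.
    rewrite /= (le_trans _ (expR_ge1Dx _))// lerDl -mulr_sumr mulNr addrC subr_ge0.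
    by rewrite ler_wpM2l//; move: tA; rewrite inE.
rewrite ge0_integralZl//; last 3 first.
- apply/measurable_EFinP.
  by apply: measurable_prod => i _; exact: mE.
- by move=> t _; rewrite lee_fin prodr_ge0// => i _; exact: expR_ge0.
- by rewrite lee_fin expR_ge0.
rewrite (ge0_integral_prod_independent (Y := fun k t => expR (l * W k t)))//; last first.
  have mf : measurable_fun setT (fun y : R => expR (l * y)).
    by apply: measurableT_comp => //; exact: measurable_funM.
  move=> S B uS mB.
  have := iW S (fun i => (fun y => expR (l * y)) @^-1` B i) uS.
  by apply => i; rewrite -[X in measurable X]setTI; exact: mf.
set z := l * m + l ^+ 2 * v * expR (l * b).
have prod_le N : (\prod_(k < N) \int[P]_t (expR (l * W k t))%:E <=
    (expR z ^+ N)%:E)%E.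
  elim: N => [|N IH]; first by rewrite big_ord0 expr0.
  rewrite big_ord_recr/= exprSr EFinM; apply: lee_pmul => //.
  - apply: prode_ge0 => k _; apply: integral_ge0 => t _.
    by rewrite lee_fin expR_ge0.
  - by apply: integral_ge0 => t _; rewrite lee_fin expR_ge0.
apply: (@le_trans _ _ (c%:E * (expR z ^+ n)%:E)%E).
  by apply: lee_wpmul2l => //; rewrite lee_fin expR_ge0.
rewrite -EFinM lee_fin /c -expRM_natl -expRD ler_expR /z.
by rewrite le_eqVlt; apply/orP; left; apply/eqP; ring.
Qed.

(** The one-sided bound applies to [W] and to [- W], whence the factor 2. *)
Lemma chernoff_sum_norm (W : nat -> T -> R) (n : nat) (b m v l x : R) :
  (forall k, measurable_fun setT (W k)) -> independent P W ->
  (forall k t, `|W k t| <= b) -> 0 <= l ->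
  (forall k, \int[P]_t (W k t)%:E = m%:E)%E ->
  (forall k, \int[P]_t (W k t ^+ 2)%:E <= v%:E)%E ->
  (P [set t | (x <= `|\sum_(k < n) W k t - n%:R * m|)%R] <=
   (2 * expR (n%:R * l ^+ 2 * v * expR (l * b) - l * x))%:E)%E.
Proof.
move=> mW iW Wb l0 Wm Wv.
have Wint k : P.-integrable setT (EFin \o W k).
  apply: (le_integrable _ _ _ (finite_measure_integrable_cst P b measurableT)) => //.
    exact/measurable_EFinP.
  by move=> t _; rewrite /= lee_fin (le_trans (Wb k t))// ler_norm.
have mlt (W' : nat -> T -> R) a : (forall k, measurable_fun setT (W' k)) ->
    measurable [set t | (a <= \sum_(k < n) W' k t)%R].
  by move=> mW'; apply: measurable_ge_set; apply: measurable_sum => k; exact: mW'.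
pose W' k t := - W k t.
have mW' k : measurable_fun setT (W' k) by exact: measurableT_comp.
have mN : measurable_fun setT (fun y : R => - y) by exact: measurableT_comp.
have iW' : independent P W'.
  move=> S B uS mB; apply: (iW S (fun i => -%R @^-1` B i) uS) => i.
  by rewrite -[X in measurable X]setTI; exact: mN.
have H1 := chernoff_sum n x mW iW Wb l0 Wm Wv.
have H2 : (P [set t | (n%:R * (- m) + x <= \sum_(k < n) W' k t)%R] <=
   (expR (n%:R * l ^+ 2 * v * expR (l * b) - l * x))%:E)%E.
  apply: chernoff_sum => //.
  - by move=> k t; rewrite normrN.
  - move=> k; under eq_integral do rewrite /W' -mulN1r EFinM.
    by rewrite (integralZl measurableT (Wint k)) Wm -EFinM mulN1r.
  - by move=> k; under eq_integral do rewrite /W' sqrrN.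
rewrite mulr2n mulrDl mul1r EFinD; apply: le_trans (leeD H1 H2).
apply: le_trans (measureU2 _ _ _); [|exact: mlt..].
apply: le_measure; rewrite ?inE.
- rewrite (_ : mkset _ = [set t | (n%:R * m + x <= \sum_(k < n) W k t)%R] `|`
    [set t | (n%:R * (- m) + x <= \sum_(k < n) W' k t)%R]).
    by apply: measurableU; exact: mlt.
  apply/seteqP; split => t /=; rewrite /W' sumrN ler_normr.
    by move=> /orP[]h; [left|right]; lra.
  by move=> []h; apply/orP; [left|right]; lra.
- by apply: measurableU; exact: mlt.
- move=> t /=; rewrite /W' sumrN ler_normr.
  by move=> /orP[]h; [left|right]; lra.
Qed.

End chernoff_bounded.

(** * Borel-Cantelli lemmas *)

Section finite_probability.
Context {d} {T : measurableType d} {R : realType} (P : probability T R).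

Definition pr (A : set T) : R := fine (P A).

Lemma prE (A : set T) : measurable A -> P A = (pr A)%:E.
Proof. by move=> mA; rewrite fineK// fin_num_measure. Qed.

Lemma pr_ge0 (A : set T) : 0 <= pr A.
Proof. exact: fine_ge0. Qed.

Lemma pr_le1 (A : set T) : measurable A -> pr A <= 1.
Proof. by move=> mA; rewrite -lee_fin -prE// probability_le1. Qed.

Lemma le_pr (A B : set T) : measurable A -> measurable B -> A `<=` B ->
  pr A <= pr B.
Proof. by move=> mA mB AB; rewrite -lee_fin -!prE// le_measure ?inE. Qed.

Lemma prC (A : set T) : measurable A -> pr (~` A) = 1 - pr A.
Proof.
move=> mA; apply: EFin_inj; rewrite -prE; last exact: measurableC.
by rewrite EFinB -prE// probability_setC.
Qed.

Lemma union_bound {I : eqType} (s : seq I) (B : I -> set T) (A : set T) :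
  measurable A -> (forall i, measurable (B i)) ->
  (forall t, A t -> exists2 i, i \in s & B i t) ->
  pr A <= \sum_(i <- s) pr (B i).
Proof.
move=> mA mB; elim: s A mA => [|i s IH] A mA AB.
  rewrite big_nil (_ : A = set0) ?/pr ?measure0//.
  by apply/seteqP; split => t // /AB[].
rewrite big_cons; apply: (@le_trans _ _ (pr (B i) + pr (A `\` B i))).
  have mD : measurable (A `\` B i) by exact: measurableD.
  rewrite -lee_fin EFinD -!prE//.
  apply: (@le_trans _ _ (P (B i `|` (A `\` B i)))); last exact: measureU2.
  apply: le_measure; rewrite ?inE//; first exact: measurableU.
  by move=> t At; have [Bt|Bt] := pselect (B i t); [left|right].
rewrite lerD2l; apply: IH; first exact: measurableD.
move=> t [/AB[j]]; rewrite in_cons => /orP[/eqP ->//|js] Bj _.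
by exists j.
Qed.

Lemma eseries_lty_bounded (u : nat -> R) m : (forall n, 0 <= u n) ->
  (\sum_(m <= n <oo) (u n)%:E < +oo)%E <->
  exists B, forall N, \sum_(m <= n < N) u n <= B.
Proof.
move=> u0; have ue0 n : (0 <= (u n)%:E)%E by rewrite lee_fin.
split=> [uoo|[B uB]].
  have ufin : (\sum_(m <= n <oo) (u n)%:E)%E \is a fin_num.
    by rewrite ge0_fin_numE//; apply: nneseries_ge0 => n _ _.
  exists (fine (\sum_(m <= n <oo) (u n)%:E)%E) => N.
  rewrite -lee_fin fineK// -sumEFin.
  by apply: nneseries_lim_ge => n _ _.
apply: (@le_lt_trans _ _ B%:E); last exact: ltry.
apply: lime_le; first by apply: is_cvg_nneseries => n _ _.
by apply: nearW => N; rewrite sumEFin lee_fin.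
Qed.

(** First Borel-Cantelli lemma. *)
Lemma ae_eventually_not (F : nat -> set T) B :
  (forall n, measurable (F n)) -> (forall N, \sum_(0 <= n < N) pr (F n) <= B) ->
  {ae P, forall t, exists N, forall n, (N <= n)%N -> ~ F n t}.
Proof.
move=> mF FB.
have Foo : (\sum_(n <oo) P (F n) < +oo)%E.
  under eq_eseriesr do rewrite prE//.
  by apply/(eseries_lty_bounded 0 (fun n => pr_ge0 (F n))); exists B.
exists (lim_sup_set F); split.
- apply: bigcap_measurable => //.
  by move=> k _; exact: bigcup_measurable.
- exact: lim_sup_set_cvg0.
move=> t h N _; apply: contrapT => hN; apply: h; exists N => n Nn Fn.
by apply: hN; exists n.
Qed.

Lemma prod_one_sub_le (x : nat -> R) N M : (forall n, 0 <= x n <= 1) ->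
  \prod_(N <= n < M) (1 - x n) <= expR (- \sum_(N <= n < M) x n).
Proof.
move=> x01; rewrite -sumrN expR_sum big_seq [leRHS]big_seq.
apply: ler_prod => n _; have /andP[x0 x1] := x01 n.
by rewrite subr_ge0 x1 expR_ge1Dx.
Qed.

(** Second Borel-Cantelli lemma, contraposed. Some [G N], on which no [F n] with [n >= N] occurs,
    has positive probability, while independence bounds that probability by [expR] of minus any
    partial sum from [N] on. *)
Lemma ae_eventually_not_summable (Y : nat -> T -> R) (a : nat -> R) :
  (forall n, measurable_fun setT (Y n)) -> independent P Y ->
  {ae P, forall t, exists N, forall n, (N <= n)%N -> Y n t < a n} ->
  exists B, forall M, \sum_(0 <= n < M) pr [set t | a n <= Y n t] <= B.
Proof.
move=> mY iY aeY; pose F n := [set t | a n <= Y n t].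
have mF n : measurable (F n) by exact: measurable_ge_set.
pose G N := \bigcap_(n in [set n | (N <= n)%N]) ~` F n.
have mG N : measurable (G N).
  apply: bigcap_measurable; first by exists N => /=.
  by move=> n _; exact: measurableC.
have [N GN] : exists N, 0 < pr (G N).
  apply: contrapT => /forallNP h.
  have G0 N : P.-negligible (G N).
    exists (G N); split => //; rewrite prE//; congr EFin.
    by apply/eqP; rewrite eq_le pr_ge0 andbT leNgt; apply/negP/h.
  have := negligibleU (negligible_bigcup G0) aeY.
  move=> [A [mA A0 subA]].
  have : P setT = 0%E.
    apply/eqP; rewrite eq_le measure_ge0 andbT -A0 le_measure ?inE// => t _.
    apply: subA; have [Gt|Gt] := pselect ((\bigcup_k G k) t); [by left|right].
    move=> /= [N hN]; apply: Gt; exists N => // n /= Nn; rewrite /F/=.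
    by apply/negP; rewrite -ltNge hN.
  move=> PT; have := @probability_setT _ _ _ P.
  by rewrite PT => /esym/eqP; rewrite onee_eq0.
(* The first [N] terms cost at most 1 each; all later ones together cost at most
   [- ln (pr (G N))]. *)
exists (N%:R - ln (pr (G N))) => M.
have x01 n : 0 <= pr (F n) <= 1 by rewrite pr_ge0 pr_le1.
have H M' : \sum_(N <= n < M') pr (F n) <= - ln (pr (G N)).
  rewrite lerNr -ler_expR lnK ?posrE//.
  apply: le_trans (prod_one_sub_le N M' x01).
  have := iY (index_iota N M') (fun n => ~` [set y | a n <= y]) (iota_uniq _ _).
  have mB n : measurable (~` [set y | a n <= y]).
    by apply: measurableC; apply: measurable_ge_set; exact: measurable_id.
  move=> /(_ mB) h.
  rewrite -lee_fin -prE// -prodEFin.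
  rewrite (eq_bigr (fun n => P (Y n @^-1` ~` [set y | a n <= y]))); last first.
    move=> n _; rewrite [X in P X](_ : _ = ~` F n)// prE ?prC//.
    exact: measurableC.
  rewrite -h; apply: le_measure; rewrite ?inE//.
    exact: (measurable_all_in (index_iota N M') mY mB).
  move=> t Gt n; rewrite mem_index_iota => /andP[Nn _]; exact: Gt.
have [NM|/ltnW MN] := leqP N M.
  rewrite (big_cat_nat (n := N))//= lerD//.
  rewrite -[leRHS]mulr1 -[N in leRHS]subn0 mulr_natl -sumr_const_nat.
  by apply: ler_sum => n _; exact: (pr_le1 (mF n)).
have h0 : 0 <= - ln (pr (G N)) by rewrite oppr_ge0 ln_le0// pr_le1.
rewrite -[leLHS]addr0 lerD//.
apply: (@le_trans _ _ (\sum_(0 <= n < M) 1)).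
  by apply: ler_sum => n _; exact: (pr_le1 (mF n)).
by rewrite sumr_const_nat subn0 ler_nat.
Qed.

Lemma ae_exists (A : T -> Prop) : {ae P, forall t, A t} -> exists t, A t.
Proof.
move=> [N [mN N0 AN]]; apply: contrapT => /forallNP hA.
have : P setT = 0%E.
  apply/eqP; rewrite eq_le measure_ge0 andbT -N0 le_measure ?inE// => t _.
  by apply: AN; exact: hA.
move=> PT; have := @probability_setT _ _ _ P.
by rewrite PT => /esym/eqP; rewrite onee_eq0.
Qed.

End finite_probability.

(** * Rows of the array *)

Lemma measurable_bigmax {d} {T : measurableType d} {R : realType} {I : Type}
    (r : seq I) (p : pred I) (F : I -> T -> R) (x : R) :
  (forall i, measurable_fun setT (F i)) ->
  measurable_fun setT (fun t => \big[Num.max/x]_(i <- r | p i) F i t).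
Proof.
move=> mF; elim: r => [|i r IH].
  rewrite (_ : (fun _ => _) = cst x); first exact: measurable_cst.
  by apply/funext => t; rewrite big_nil.
rewrite (_ : (fun _ => _) = fun t => if p i then
    Num.max (F i t) (\big[Num.max/x]_(i <- r | p i) F i t) else
    \big[Num.max/x]_(i <- r | p i) F i t); last first.
  by apply/funext => t; rewrite big_cons.
case: (p i) => //; exact: measurable_maxr.
Qed.

(** Change of variables is applied to nonnegative integrands, so the positive and the negative part
    of [f] are treated apart. *)
Lemma eq_integral_law {d} {T : measurableType d} {R : realType}
    (P : probability T R) (Y Z : T -> R) (f : R -> R) :
  measurable_fun setT Y -> measurable_fun setT Z -> measurable_fun setT f ->
  (forall B, measurable B -> P (Y @^-1` B) = P (Z @^-1` B)) ->
  (\int[P]_t (f (Y t))%:E = \int[P]_t (f (Z t))%:E)%E.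
Proof.
move=> mY mZ mf YZ.
have H (g : R -> \bar R) : measurable_fun setT g -> (forall y, 0 <= g y)%E ->
    (\int[P]_t g (Y t) = \int[P]_t g (Z t))%E.
  move=> mg g0.
  transitivity (\int[pushforward P Y]_y g y)%E.
    by rewrite ge0_integral_pushforward.
  transitivity (\int[pushforward P Z]_y g y)%E; last first.
    by rewrite ge0_integral_pushforward.
  pose mu := measure_function_pushforward__canonical__measure_function_Measure P mZ.
  pose nu := measure_function_pushforward__canonical__measure_function_Measure P mY.
  by apply: (@eq_measure_integral _ _ _ _ mu nu) => A mA _; exact: YZ.
have mEf : measurable_fun setT (EFin \o f) by exact/measurable_EFinP.
rewrite integralE [RHS]integralE; congr (_ - _)%E.
  rewrite (eq_integral (fun t => (EFin \o f)^\+ (Y t))%E); last first.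
    by move=> t _; rewrite !funeposE.
  rewrite [RHS](eq_integral (fun t => (EFin \o f)^\+ (Z t))%E); last first.
    by move=> t _; rewrite !funeposE.
  by apply: (H ((EFin \o f)^\+)%E) => //; exact: measurable_funepos.
rewrite (eq_integral (fun t => (EFin \o f)^\- (Y t))%E); last first.
  by move=> t _; rewrite !funenegE.
rewrite [RHS](eq_integral (fun t => (EFin \o f)^\- (Z t))%E); last first.
  by move=> t _; rewrite !funenegE.
by apply: (H ((EFin \o f)^\-)%E) => //; exact: measurable_funeneg.
Qed.

Section rowmax.
Context {R : realType}.

(** The formula of [Mstat] as a function on path space, so that equality of joint laws and
    independence of blocks apply to it. *)
Definition rowmax (m : nat) (w : nat -> R * R) : R :=
  \big[Num.max/0]_(i < m) \big[Num.max/0]_(j < m | i != j)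
    `|(w i).1 * (w j).2|.

(** Positivity of [x] rules out the default value 0 of an empty maximum. *)
Lemma rowmaxP m (w : nat -> R * R) x : 0 < x ->
  x <= rowmax m w <-> exists i j : nat,
    [/\ (i < m)%N, (j < m)%N, i != j & x <= `|(w i).1 * (w j).2|].
Proof.
move=> x0; split.
  move=> /bigmax_geP[|[i _]]; first by rewrite leNgt x0.
  move=> /bigmax_geP[|[j ij xij]]; first by rewrite leNgt x0.
  by exists i, j.
move=> [i [j [im jm ij xij]]]; apply/bigmax_geP; right.
exists (Ordinal im) => //; apply/bigmax_geP; right.
by exists (Ordinal jm).
Qed.

Lemma measurable_rowmax m :
  measurable_fun setT (rowmax m : path_space nat (R * R)%type -> R).
Proof.
apply: measurable_bigmax => i; apply: measurable_bigmax => j.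
apply: measurableT_comp; first exact: normr_measurable.
apply: measurable_funM.
  by apply: measurableT_comp; [exact: measurable_fst|exact: measurable_path_coord].
by apply: measurableT_comp; [exact: measurable_snd|exact: measurable_path_coord].
Qed.

(** Two distinct columns are indexed by [bool]: [false] supplies the factor from [U], [true] the
    factor from [V]. *)
Definition crossprod (w : bool -> R * R) : R := (w false).1 * (w true).2.

Lemma measurable_crossprod :
  measurable_fun setT (crossprod : path_space bool (R * R)%type -> R).
Proof.
apply: measurable_funM.
  by apply: measurableT_comp; [exact: measurable_fst|exact: measurable_path_coord].
by apply: measurableT_comp; [exact: measurable_snd|exact: measurable_path_coord].
Qed.

End rowmax.

Section iid_array.
Context {d} {T : measurableType d} {R : realType} {P : probability T R}.
Variables (U V : nat -> nat -> {RV P >-> R}).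
Let X (ki : nat * nat) (t : T) : R * R := (U ki.1 ki.2 t, V ki.1 ki.2 t).
Hypothesis indX : mutually_independent_pairs P X.
Hypothesis idX : identically_distributed_pairs P X.

Let mX ki : measurable_fun setT (X ki).
Proof. exact: measurable_fun_pair. Qed.

Let iX : independent P X.
Proof. by move=> S B uS mB; exact: indX. Qed.

Definition rowmax_tail (m : nat) (x : R) : R :=
  pr P [set t | x <= rowmax m (fun c => (U 0 c t, V 0 c t))].

Lemma measurable_rowmax_array m (s : nat -> nat * nat) :
  measurable_fun setT (fun t => rowmax m (fun c => X (s c) t)).
Proof.
have mXs c : measurable_fun setT (X (s c)) by exact: mX.
exact: (measurableT_comp (measurable_rowmax m) (measurable_joint mXs)).
Qed.

(** Distinct entries are i.i.d., so the choice [s] does not affect the joint law. It is used both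
    for other rows and for rearranged columns of the first row. *)
Lemma pr_rowmax m x (s : nat -> nat * nat) : injective s ->
  pr P [set t | x <= rowmax m (fun c => X (s c) t)] = rowmax_tail m x.
Proof.
move=> sI; rewrite /rowmax_tail /pr; congr fine.
have s0I : injective (pair 0%N : nat -> nat * nat) by move=> ? ? [].
apply: (eq_joint_law (X := fun c => X (s c)) (Y := fun c => X (0%N, c))
  (fun=> mX _) (fun=> mX _) (independent_inj sI iX) (independent_inj s0I iX)
  (fun i B mB => idX _ _ mB) (E := [set w | x <= rowmax m w])).
by apply: measurable_ge_set; exact: measurable_rowmax.
Qed.

Lemma rowmax_tail_ge0 m x : 0 <= rowmax_tail m x. Proof. exact: pr_ge0. Qed.

Lemma measurable_row_ge m x (s : nat -> nat * nat) :
  measurable [set t | x <= rowmax m (fun c => X (s c) t)].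
Proof. by apply: measurable_ge_set; exact: measurable_rowmax_array. Qed.

Lemma measurable_cross k i j : measurable_fun setT (fun t => U k i t * V k j t).
Proof. exact: measurable_funM. Qed.

Lemma cross_law k i j (B : set R) : i != j -> measurable B ->
  P ((fun t => U k i t * V k j t) @^-1` B) =
  P ((fun t => U 0%N 0%N t * V 0%N 1%N t) @^-1` B).
Proof.
move=> ij mB.
pose s k i j (b : bool) : nat * nat := (k, if b then j else i).
have sI k' i' j' : i' != j' -> injective (s k' i' j').
  by move=> /eqP ij' [] [] //= [] // /esym.
apply: (eq_joint_law (X := fun b => X (s k i j b))
  (Y := fun b => X (s 0%N 0%N 1%N b)) (fun=> mX _) (fun=> mX _)
  (independent_inj (sI _ _ _ ij) iX) (independent_inj (sI 0%N 0%N 1%N isT) iX)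
  (fun i B mB => idX _ _ mB) (E := crossprod @^-1` B)).
by rewrite -[X in measurable X]setTI; exact: measurable_crossprod.
Qed.

Lemma independent_cross i j : i != j ->
  independent P (fun k t => U k i t * V k j t).
Proof.
move=> /eqP ij; pose s (kb : nat * bool) : nat * nat := (kb.1, if kb.2 then j else i).
have sI : injective s.
  by move=> [k []] [l []]//= [] -> // /esym.
apply: (independent_blocks (X := fun kb => X (s kb)) (f := fun=> crossprod)
  (fun=> mX _) (fun=> measurable_crossprod) (independent_inj sI iX)).
Qed.

(** Columns [2 l] and [2 l + 1] form disjoint blocks, which yields [n / 2] independent copies of [Z]
    in a row of [n] columns. *)
Lemma independent_first_row :
  independent P (fun l t => U 0%N l.*2 t * V 0%N l.*2.+1 t).
Proof.
pose s (kb : nat * bool) : nat * nat := (0%N, if kb.2 then kb.1.*2.+1 else kb.1.*2).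
have sI : injective s.
  by move=> [k []] [l []]//= [] h; congr pair; lia.
apply: (independent_blocks (X := fun kb => X (s kb)) (f := fun=> crossprod)
  (fun=> mX _) (fun=> measurable_crossprod) (independent_inj sI iX)).
Qed.

Lemma independent_rows (q : nat -> nat) :
  independent P (fun k t => rowmax (q k) (fun c => X (k, c) t)).
Proof.
exact: (independent_blocks (X := X) (f := fun k => rowmax (q k))
  mX (fun k => measurable_rowmax (q k)) iX).
Qed.

Lemma independent2_UV : independent2 P (U 0%N 0%N) (V 0%N 1%N).
Proof.
move=> A B mA mB.
have := independent_pair (i := (0%N, 0%N)) (j := (0%N, 1%N)) (A := fst @^-1` A)
  (B := snd @^-1` B) iX isT.
apply.
  by rewrite -[X in measurable X]setTI; exact: measurable_fst.
by rewrite -[X in measurable X]setTI; exact: measurable_snd.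
Qed.

(* Two columns always lie in the union of two of the [a] blocks of size [h]. *)
Lemma rowmax_tail_scale (m a h m2 : nat) x : 0 < x -> (m <= a * h)%N -> (h.*2 <= m2)%N ->
  rowmax_tail m x <= (a ^ 2)%:R * rowmax_tail m2 x.
Proof.
move=> x0 mah hm2.
have [h0|h0] := posnP h.
  have m0 : m = 0%N by apply/eqP; rewrite -leqn0 (leq_trans mah)// h0 muln0.
  rewrite [rowmax_tail m x](_ : _ = 0) ?mulr_ge0 ?rowmax_tail_ge0// /rowmax_tail /pr m0.
  rewrite (_ : mkset _ = set0) ?measure0//.
  by apply/seteqP; split => t //= /(rowmaxP _ _ x0)[i [j []]].
(* [phi b] lists the columns of block [b.1], then those of block [b.2]. If the blocks differ, later
   positions go beyond column [a * h], only to keep [phi b] injective. *)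
pose phi (b : nat * nat) c := if b.1 == b.2 then (b.1 * h + c)%N else
  if (c < h)%N then (b.1 * h + c)%N else
  if (c < h.*2)%N then (b.2 * h + (c - h))%N else (a * h + c)%N.
pose s := [seq (b1, b2) | b1 <- iota 0 a, b2 <- iota 0 a].
pose B b := if (b.1 < a)%N && (b.2 < a)%N then
  [set t | x <= rowmax m2 (fun c => X (0%N, phi b c) t)] else set0.
have phiI b : (b.1 < a)%N -> (b.2 < a)%N -> injective (fun c => (0%N, phi b c)).
  case: b => b1 b2 /= b1a b2a c1 c2 []; rewrite /phi/=.
  have e1 : (b1 * h + h <= a * h)%N by rewrite -mulSnr leq_mul2r b1a orbT.
  have e2 : (b2 * h + h <= a * h)%N by rewrite -mulSnr leq_mul2r b2a orbT.
  have [_|] := eqVneq b1 b2; first lia.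
  rewrite neq_ltn => /orP[]blt.
    have e3 : (b1 * h + h <= b2 * h)%N by rewrite -mulSnr leq_mul2r blt orbT.
    by do ! case: ifP; lia.
  have e3 : (b2 * h + h <= b1 * h)%N by rewrite -mulSnr leq_mul2r blt orbT.
  by do ! case: ifP; lia.
have mB b : measurable (B b).
  by rewrite /B; case: ifP => _ //; exact: (measurable_row_ge _ _ (fun c => (0%N, phi b c))).
apply: (@le_trans _ _ (\sum_(b <- s) pr P (B b))).
  apply: union_bound => //; first exact: (measurable_row_ge _ _ (pair 0%N)).
  move=> t /= /(rowmaxP _ _ x0)[i [j [im jm ij xij]]].
  have ia : (i %/ h < a)%N by rewrite ltn_divLR// (leq_trans im).
  have ja : (j %/ h < a)%N by rewrite ltn_divLR// (leq_trans jm).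
  exists (i %/ h, j %/ h)%N.
    by apply/allpairsP; exists (i %/ h, j %/ h)%N; rewrite !mem_iota.
  rewrite /B/= ia ja/=; apply/rowmaxP => //.
  have [ih jh] := (ltn_pmod i h0, ltn_pmod j h0).
  (* In a common block the positions are the residues modulo [h]; otherwise column [j] is found in
     the second block, shifted by [h]. *)
  have [eij|nij] := eqVneq (i %/ h)%N (j %/ h)%N.
    exists (i %% h)%N, (j %% h)%N; split.
    - by lia.
    - by lia.
    - apply: contra ij => /eqP e; apply/eqP.
      by rewrite (divn_eq i h) (divn_eq j h) eij e.
    - by rewrite /phi/= eij eqxx -{1}eij -!divn_eq.
  exists (i %% h)%N, (h + j %% h)%N; split.
  - by lia.
  - by lia.
  - by apply/eqP; lia.
  - rewrite /phi/= (negbTE nij) ih ltnNge leq_addr/= -addnn ltn_add2l jh addKn.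
    by rewrite -!divn_eq.
rewrite -mulnn big_seq (eq_bigr (fun=> rowmax_tail m2 x)); last first.
  move=> [b1 b2] /allpairsP[[c1 c2]/= []]; rewrite !mem_iota /= !add0n => c1a c2a [-> ->].
  by rewrite /B/= c1a c2a/= (pr_rowmax _ _ (phiI (c1, c2) c1a c2a)).
rewrite -big_seq big_const_seq count_predT size_allpairs !size_iota.
by rewrite iter_addr_0 mulr_natl.
Qed.

End iid_array.

(** * Tails and moments of a product *)

Section bounded_sums.
Context {R : realType}.

Definition bounded_sums (u : nat -> R) :=
  exists B, forall N, \sum_(0 <= n < N) u n <= B.

Lemma bounded_sums_eventually_le (u v : nat -> R) c N0 :
  (forall n, 0 <= v n) -> 0 <= c -> (forall n, (N0 <= n)%N -> u n <= c * v n) ->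
  bounded_sums v -> bounded_sums u.
Proof.
move=> v0 c0 uv [B vB]; exists (\sum_(0 <= n < N0) `|u n| + c * B) => N.
apply: (@le_trans _ _ (\sum_(0 <= n < N) (`|u n| *+ (n < N0)%N + c * v n))).
  apply: ler_sum => n _; have [nN|Nn] := ltnP n N0.
    by rewrite mulr1n -[leLHS]addr0 lerD ?ler_norm ?mulr_ge0.
  by rewrite mulr0n add0r uv.
rewrite big_split/= -mulr_sumr lerD//; last exact: ler_wpM2l.
have [NN0|/ltnW N0N] := leqP N N0.
  rewrite [leRHS](big_cat_nat (n := N))//= -[leLHS]addr0 lerD//; last first.
    by apply: sumr_ge0.
  by apply: ler_sum => n _; case: (n < N0)%N; rewrite ?mulr1n ?mulr0n.
rewrite (big_cat_nat (n := N0))//= -[leRHS]addr0 lerD//.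
  by apply: ler_sum => n _; case: (n < N0)%N; rewrite ?mulr1n ?mulr0n.
rewrite big_nat big1// => n /andP[Nn _].
by rewrite ltnNge Nn mulr0n.
Qed.

Lemma bounded_sums_cvg0 (u : nat -> R) : (forall n, 0 <= u n) ->
  bounded_sums u -> u @ \oo --> (0 : R).
Proof.
move=> u0 [B uB]; apply: cvg_series_cvg_0.
apply: nondecreasing_is_cvgn.
  by apply: nondecreasing_series => n _ _.
by exists B => _ [N _ <-]; exact: uB.
Qed.

Lemma bounded_sums_from1 (u : nat -> R) : (forall n, 0 <= u n) ->
  (exists B, forall N, \sum_(1 <= n < N) u n <= B) <-> bounded_sums u.
Proof.
move=> u0; split=> [[B uB]|[B uB]].
  exists (u 0%N + B) => -[|N].
    rewrite big_nil addr_ge0//.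
    by have := uB 0%N; rewrite big_geq.
  by rewrite big_ltn// lerD2l.
exists B => N; apply: le_trans (uB N).
case: N => [|N]; first by rewrite !big_geq.
by rewrite [leRHS]big_ltn// lerDr.
Qed.

Lemma bounded_sums_inv_sq : bounded_sums (fun n => (n%:R ^+ 2)^-1 : R).
Proof.
exists 2 => N.
(* Telescoping with [1 / (x + 1)^2 <= 1 / x - 1 / (x + 1)]; the term [n = 0] is 0 by the convention
   on inverses. *)
suff: \sum_(0 <= n < N.+2) (n%:R ^+ 2)^-1 <= 2 - N.+1%:R^-1 :> R.
  rewrite (big_cat_nat (n := N))/=; [move=> h|by []|by lia].
  apply: (@le_trans _ _ (2 - N.+1%:R^-1)); last by rewrite gerBl invr_ge0.
  apply: le_trans h; rewrite lerDl; apply: sumr_ge0 => i _.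
  by rewrite invr_ge0 sqr_ge0.
elim: N => [|N IH].
  by rewrite big_nat_recr//= big_nat1 expr0n/= invr0 expr1n invr1; lra.
rewrite big_nat_recr//=; apply: (le_trans (lerD IH (lexx _))).
have N0 : 0 < N.+1%:R :> R by rewrite ltr0n.
rewrite -[N.+2%:R]natr1; set x := N.+1%:R in N0 *.
have : ((x + 1) ^+ 2)^-1 <= (x * (x + 1))^-1.
  by rewrite lef_pV2 ?posrE ?mulr_gt0 ?exprn_gt0//; [nra|lra..].
have -> : (x * (x + 1))^-1 = x^-1 - (x + 1)^-1 by field; rewrite !gt_eqF//; lra.
by move: (x^-1) ((x + 1)^-1) (((x + 1) ^+ 2)^-1) => u v w; lra.
Qed.
End bounded_sums.

(** * Moments from summable tails *)

Section moment.
Context {d} {T : measurableType d} {R : realType} (P : probability T R).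

(** With [N] the integer part of [|Z|^(1/a)], one has [|Z|^s <= (N + 1)^2 <= 1 + sum of 3 n over n
    <= N], and [n <= N] means [|Z| >= n^a]. Integrate term by term. *)
Lemma integral_powR_lty_tail (Z : T -> R) (a s : R) :
  measurable_fun setT Z -> 0 < a -> 0 < s -> a * s <= 2 ->
  bounded_sums (fun n => n%:R * pr P [set t | n%:R `^ a <= `|Z t|]) ->
  (\int[P]_t (`|Z t| `^ s)%:E < +oo)%E.
Proof.
move=> mZ a0 s0 as2 bs.
pose A n := [set t | n%:R `^ a <= `|Z t|].
have mA n : measurable (A n).
  by apply: measurable_ge_set; apply: measurableT_comp.
(* The constant 3 comes from [(x + 1)^2 - x^2 = 2 x + 1 <= 3 x] for [x >= 1]. *)
pose g n t : \bar R := (3 * n%:R * \1_(A n) t)%:E.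
have g0 n t : (0 <= g n t)%E by rewrite lee_fin mulr_ge0 ?mulr_ge0.
have mg n : measurable_fun setT (g n).
  by apply/measurable_EFinP; apply: measurable_funM => //; exact: measurable_indic.
have pt t : ((`|Z t| `^ s)%:E <= 1 + \sum_(n <oo) g n t)%E.
  set w := `|Z t| `^ a^-1; set N := Num.truncn w.
  have w0 : 0 <= w by exact: powR_ge0.
  have Zw : `|Z t| = w `^ a.
    by rewrite /w -powRrM mulVf ?gt_eqF// powRr1.
  apply: (@le_trans _ _ (1 + \sum_(0 <= n < N.+1) g n t)%E); last first.
    by rewrite leeD2l//; apply: nneseries_lim_ge => n _ _.
  have -> : (\sum_(0 <= n < N.+1) g n t)%E = (\sum_(0 <= n < N.+1) 3 * n%:R)%:E.
    rewrite -sumEFin big_nat [RHS]big_nat; apply: eq_bigr => n /=.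
    rewrite ltnS /g => nN; congr EFin.
    rewrite indicE mem_set ?mulr1// /A/= Zw ge0_ler_powR ?nnegrE//; first exact: ltW.
    by rewrite -truncn_ge_nat.
  rewrite -EFinD lee_fin Zw -powRrM.
  apply: (@le_trans _ _ (N.+1%:R `^ 2)).
    apply: (@le_trans _ _ (N.+1%:R `^ (a * s))).
      rewrite ge0_ler_powR ?nnegrE//; first by rewrite mulr_ge0 ?ltW.
      exact/ltW/truncnS_gt.
    by rewrite ler_powR// ler1n.
  rewrite powR_mulrn//; elim: N => [|N IH]; first by rewrite big_nat1; lra.
  rewrite big_nat_recr//= addrA -[N.+2%:R]natr1.
  have : 1 <= N.+1%:R :> R by rewrite ler1n.
  by move: IH; set x := N.+1%:R; nra.
apply: (@le_lt_trans _ _ (\int[P]_t (1 + \sum_(n <oo) g n t))%E).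
  apply: ge0_le_integral => //.
  - apply/measurable_EFinP; apply: measurableT_comp (measurable_powR s) _.
    exact: measurableT_comp.
  - apply: emeasurable_funD => //; apply: ge0_emeasurable_sum => //.
rewrite ge0_integralD//; last 2 first.
- by move=> t _; exact: nneseries_ge0.
- exact: ge0_emeasurable_sum.
rewrite integral_nneseries// (integral_cst P measurableT 1%:E) mul1e.
rewrite [X in (X + _ < _)%E](_ : _ = 1%E); last exact: probability_setT.
rewrite lte_add_pinfty ?ltry//.
rewrite (_ : (\sum_(n <oo) _)%E = (\sum_(n <oo) (3 * (n%:R * pr P (A n)))%:E)%E).
  apply/eseries_lty_bounded => [n|]; first by rewrite !mulr_ge0 ?pr_ge0.
  have [B bB] := bs; exists (3 * B) => N; rewrite -mulr_sumr ler_pM2l//.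
apply: eq_eseriesr => n _.
rewrite /g; under eq_integral do rewrite EFinM.
rewrite ge0_integralZl//.
- rewrite (integral_indic P measurableT (mA n)) setIT.
  by rewrite [X in (_ * X)%E](prE P (mA n)) -EFinM mulrA.
- exact/measurable_EFinP/measurable_indic.
Qed.

End moment.

Section iid_array.
Context {d} {T : measurableType d} {R : realType} {P : probability T R}.
Variables (U V : nat -> nat -> {RV P >-> R}).
Let X (ki : nat * nat) (t : T) : R * R := (U ki.1 ki.2 t, V ki.1 ki.2 t).
Hypothesis indX : mutually_independent_pairs P X.
Hypothesis idX : identically_distributed_pairs P X.

Local Notation Z := (fun t => U 0%N 0%N t * V 0%N 1%N t).

(** If [x] is the tail of [|Z|] at [y] and [Q] that of the row, the [h] disjoint pairs of columns
    give [1 - Q <= (1 - x)^h <= 1 / (1 + h x)]; the statement is this inequality cleared of its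
    denominator. *)
Lemma rowmax_tail_pairs (n h : nat) (y : R) : 0 < y -> (h.*2 <= n)%N ->
  h%:R * pr P [set t | y <= `|Z t|] <= rowmax_tail U V n y * (1 + h%:R * pr P [set t | y <= `|Z t|]).
Proof.
move=> y0 hn; set x := pr P _.
have mE i j : measurable [set t | y <= `|U 0%N i t * V 0%N j t|].
  apply: measurable_ge_set; apply: measurableT_comp => //.
  exact: measurable_cross.
have x01 : 0 <= x <= 1 by rewrite pr_ge0 pr_le1.
have mQ : measurable [set t | y <= rowmax n (fun c => (U 0%N c t, V 0%N c t))].
  exact: (measurable_row_ge U V n y (pair 0%N)).
have H : 1 - rowmax_tail U V n y <= (1 - x) ^+ h.
  rewrite -prC//.
  have iF : independent P _ := independent_first_row indX.
  have := iF (iota 0 h) (fun=> ~` [set z | y <= `|z|]) (iota_uniq _ _).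
  have mB : measurable (~` [set z : R | y <= `|z|]).
    by apply: measurableC; apply: measurable_ge_set.
  move=> /(_ (fun=> mB)) hh.
  have -> : (1 - x) ^+ h = \prod_(l <- iota 0 h) (1 - x).
    by rewrite big_const_seq count_predT size_iota iter_mulr_1.
  rewrite -lee_fin -prE; last exact: measurableC.
  rewrite -prodEFin (eq_bigr (fun l => P ((fun t => U 0%N l.*2 t * V 0%N l.*2.+1 t) @^-1`
    (~` [set z | y <= `|z|])))); last first.
    move=> l _; rewrite (cross_law indX idX)//; last by apply/eqP; lia.
    rewrite [X in P X](_ : _ = ~` [set t | y <= `|Z t|])// prE ?prC//.
    exact: measurableC.
  rewrite -hh; apply: le_measure; rewrite ?inE//; first exact: measurableC.
    exact: (measurable_all_in (iota 0 h)
      (fun l => measurable_cross U V 0 l.*2 l.*2.+1) (fun=> mB)).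
  move=> t /= tQ l; rewrite mem_iota add0n => /= lh yl; apply: tQ.
  apply/rowmaxP => //; exists l.*2, l.*2.+1; split => //; [lia|lia|].
  by apply/eqP; lia.
have G : (1 - x) ^+ h * (1 + h%:R * x) <= 1.
  elim: (h) => [|k IH]; first by rewrite expr0 mul0r addr0 mulr1.
  apply: le_trans IH; rewrite exprSr -mulrA ler_wpM2l ?exprn_ge0//; first lra.
  rewrite -natr1; have k0 : 0 <= k%:R :> R by [].
  by nra.
have hx0 : 0 <= h%:R * x by rewrite mulr_ge0//; lra.
have : (1 - rowmax_tail U V n y) * (1 + h%:R * x) <= 1.
  by apply: le_trans G; rewrite ler_wpM2r//; lra.
lra.
Qed.

Lemma bounded_sums_tail (a : R) : 0 < a ->
  bounded_sums (fun n => rowmax_tail U V n (n%:R `^ a)) ->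
  bounded_sums (fun n => n%:R * pr P [set t | n%:R `^ a <= `|Z t|]).
Proof.
move=> a0 bs; have Q0 n : 0 <= rowmax_tail U V n (n%:R `^ a) by exact: rowmax_tail_ge0.
have /cvgrPdist_le/(_ (2^-1)) := bounded_sums_cvg0 Q0 bs.
move=> /(_ ltac:(lra))[N0 _ hN0].
(* Once the row tail [q] is at most 1/2, [h x <= q (1 + h x)] gives [h x <= 2 q] for [h = n./2]; and
   [n <= 3 h] when [n >= 2]. Hence 6. *)
apply: (bounded_sums_eventually_le (N0 := maxn N0 2) (c := 6) Q0 _ _ bs) => //.
move=> n; rewrite geq_max => /andP[/hN0/= + n2].
rewrite sub0r normrN ger0_norm// => Q2.
have na0 : 0 < n%:R `^ a :> R by rewrite powR_gt0// ltr0n; lia.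
have := rowmax_tail_pairs (n := n) (h := n./2) na0 ltac:(lia).
set x := pr P _ => hh; have x0 : 0 <= x by exact: pr_ge0.
have n3 : n%:R <= 3 * (n./2)%:R :> R by rewrite -natrM ler_nat; lia.
have k0 : 0 <= (n./2)%:R :> R by [].
set q := rowmax_tail _ _ _ _ in Q2 hh *; have q0 : 0 <= q by exact: rowmax_tail_ge0.
have : (n./2)%:R * x <= 2 * q.
  have kx0 : 0 <= (n./2)%:R * x by rewrite mulr_ge0.
  nra.
have : n%:R * x <= 3 * (n./2)%:R * x by rewrite ler_wpM2r.
lra.
Qed.

End iid_array.

(** * Truncation *)

Section truncation.
Context {R : realType}.
Implicit Types b s x z : R.

Definition trunc b z := if `|z| <= b then z else 0.

Lemma measurable_trunc b : measurable_fun setT (trunc b).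
Proof.
have mA : measurable [set z : R | - b <= - `|z|].
  apply: measurable_ge_set; apply: measurableT_comp => //.
rewrite (_ : trunc b = fun z => z * \1_[set z : R | - b <= - `|z|] z).
  by apply: measurable_funM => //; exact: measurable_indic.
apply/funext => z; rewrite /trunc indicE; case: ifPn => zb.
  by rewrite mem_set ?mulr1//= lerN2.
by rewrite memNset ?mulr0//= lerN2; apply/negP.
Qed.

Lemma trunc_le b z : 0 <= b -> `|trunc b z| <= b.
Proof. by rewrite /trunc => b0; case: ifP => //; rewrite normr0. Qed.

Lemma powRDpos x (p q : R) : 0 < x -> x `^ (p + q) = x `^ p * x `^ q.
Proof. by move=> x0; rewrite powRD// (gt_eqF x0) implybT. Qed.

(** Where the truncation is not zero, [|z|^q = |z|^(q - s) |z|^s] and the first factor is at most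
    [b^(q - s)]. It serves with [q = 2] for the second moment and with [q = 1] for the mean when
    [s <= 1]. *)
Lemma trunc_moment b s z (q : R) : 0 < b -> 0 < q -> s <= q ->
  `|trunc b z| `^ q <= b `^ (q - s) * `|z| `^ s.
Proof.
move=> b0 q0 sq; have nn : 0 <= b `^ (q - s) * `|z| `^ s.
  by rewrite mulr_ge0 ?powR_ge0.
rewrite /trunc; case: ifP => zb; last by rewrite normr0 powR0// gt_eqF.
have [z0|z0] := eqVneq z 0.
  by move: nn; rewrite z0 normr0 (powR0 (negbT (gt_eqF q0))).
have r0 : 0 < `|z| by rewrite normr_gt0.
have -> : `|z| `^ q = `|z| `^ (q - s) * `|z| `^ s by rewrite -powRDpos// subrK.
rewrite ler_wpM2r ?powR_ge0//.
by rewrite ge0_ler_powR ?nnegrE// ?subr_ge0// ltW.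
Qed.

(** Only [|z| > b] matters, and there [|z|^(1 - s) <= b^(1 - s)] because the exponent is not
    positive. *)
Lemma trunc_tail b s z : 0 < b -> 1 <= s ->
  `|trunc b z - z| <= b `^ (1 - s) * `|z| `^ s.
Proof.
move=> b0 s1; rewrite /trunc; case: ifPn => zb.
  by rewrite subrr normr0 mulr_ge0 ?powR_ge0.
rewrite sub0r normrN; rewrite -ltNge in zb.
have r0 : 0 < `|z| by exact: lt_trans zb.
rewrite -{1}(powRr1 (ltW r0)) -{1}(subrK s 1) powRDpos// ler_wpM2r ?powR_ge0//.
rewrite -(opprB s) !powRN lef_pV2 ?posrE ?powR_gt0//.
by rewrite ge0_ler_powR ?nnegrE ?subr_ge0// ltW.
Qed.

Lemma natr_powR_ge (c K : R) : 0 < c ->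
  exists N0, forall n, (N0 <= n)%N -> K <= n%:R `^ c.
Proof.
move=> c0; exists (Num.truncn (`|K| `^ c^-1)).+1 => n Nn.
apply: (le_trans (ler_norm K)).
have -> : `|K| = (`|K| `^ c^-1) `^ c.
  by rewrite -powRrM mulVf ?gt_eqF// powRr1.
apply: ge0_ler_powR; rewrite ?nnegrE ?powR_ge0//; first exact: ltW.
by apply/ltW/(lt_le_trans (truncnS_gt _)); rewrite ler_nat.
Qed.

(* With [b = delta n^a] and [l = eta ln n / b] the Chernoff exponent
   [l eps n^a] equals [4 ln n], while the variance term is [O((ln n)^2 n^-eta)]. *)
Lemma chernoff_parameters (C a s eps : R) :
  0 <= C -> 1 < a * s -> 0 < eps ->
  exists delta : R, 0 < delta /\ exists N0, forall n, (N0 <= n)%N ->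
  let b := delta * n%:R `^ a in
  n%:R * (b `^ (1 - s) * C) <= eps * n%:R `^ a /\
  exists l : R, 0 <= l /\
    n%:R * l ^+ 2 * (b `^ (2 - s) * C) * expR (l * b) - l * (eps * n%:R `^ a)
    <= 1 - 4 * ln n%:R.
Proof.
move=> C0 as1 eps0.
(* [a * s = 1 + 2 * eta]: one power of [n] pays for the number of summands, and [n^(2 eta)] remains
   as gain. *)
pose eta := (a * s - 1) / 2; have eta0 : 0 < eta by rewrite /eta; lra.
have e4 : eta / 4 * 4%:R = eta by lra.
have e8 : eta / 4 * 8%:R = 2 * eta by lra.
pose delta := eta * eps / 4.
have delta0 : 0 < delta by apply: divr_gt0; [exact: mulr_gt0|lra].
exists delta; split => //.
have [N1 hN1] := natr_powR_ge (C * delta `^ (1 - s) / eps) (c := 2 * eta) ltac:(lra).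
(* The summand 1 ensures [w >= 1] below, and 16 is the square of 4 in [eta * ln x <= 4 w]. *)
have [N2 hN2] := natr_powR_ge (1 + 16 * C * delta `^ (- s)) (c := eta / 4) ltac:(lra).
exists (maxn 1 (maxn N1 N2)) => n; rewrite !geq_max => /and3P[n1 nN1 nN2] b.
have x0 : 0 < n%:R :> R by rewrite ltr0n.
have x1 : 1 <= n%:R :> R by rewrite ler1n.
have {hN1 nN1} := hN1 _ nN1; have {hN2 nN2} := hN2 _ nN2.
move: x0 x1 @b; set x : R := n%:R => x0 x1 b.
(* Everything is measured in [w]: [expR (l b) = x^eta = w^4], the gain is [u = w^8], and
   [ln x <= (4 / eta) w]. The variance term is then at most [16 C D / w^2], with
   [D = delta^(- s)]. *)
set w := x `^ (eta / 4); set u := x `^ (2 * eta) => hw hu.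
have xa0 : 0 < x `^ a by rewrite powR_gt0.
have u0 : 0 < u by rewrite powR_gt0.
have b0 : 0 < b by rewrite mulr_gt0.
have bE p : b `^ p = delta `^ p * x `^ (a * p).
  by rewrite /b powRM ?ltW// -powRrM.
split.
  have -> : x * (b `^ (1 - s) * C) = C * delta `^ (1 - s) * x `^ a / u.
    rewrite bE.
    have -> : x `^ (a * (1 - s)) = x `^ a / (x * u).
      have -> : a * (1 - s) = a + - (1 + 2 * eta) by rewrite /eta; field.
      by rewrite powRDpos// powRN powRDpos// powRr1// ltW.
    by field; rewrite !gt_eqF.
  rewrite ler_pdivrMr//; move: hu; rewrite ler_pdivrMr// => hu.
  rewrite [leRHS]mulrAC; apply: ler_wpM2r; first exact: ltW.
  by rewrite [leRHS]mulrC.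
have L0 : 0 <= ln x by rewrite ln_ge0.
exists (eta * ln x / b); split.
  apply: divr_ge0; last exact: ltW.
  by apply: mulr_ge0; first exact: ltW.
have -> : eta * ln x / b * b = eta * ln x by field; rewrite gt_eqF.
have -> : eta * ln x / b * (eps * x `^ a) = 4 * ln x.
  by rewrite /b /delta; field; rewrite !gt_eqF.
rewrite lerD2r.
have -> : expR (eta * ln x) = w ^+ 4.
  by rewrite -powR_mulrn ?powR_ge0// /w -powRrM e4 /powR gt_eqF.
have w0 : 0 < w by rewrite powR_gt0.
have w8 : x `^ (2 * eta) = w ^+ 8.
  by rewrite -powR_mulrn ?powR_ge0// /w -powRrM e8.
have Lw : ln x <= 4 / eta * w.
  have : ln w <= w.
    rewrite -ler_expR lnK ?posrE//; apply: le_trans (expR_ge1Dx w).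
    by rewrite lerDr.
  rewrite /w ln_powR => h.
  by rewrite mulrAC ler_pdivlMr//; move: h; rewrite -/w; lra.
have -> : b `^ (2 - s) = b ^+ 2 * (delta `^ (- s) / (x * w ^+ 8)).
  rewrite powRDpos// powR_mulrn ?(ltW b0)// bE; congr (_ * (_ * _)).
  have -> : a * - s = - (1 + 2 * eta) by rewrite /eta; field.
  by rewrite powRN powRDpos// w8 powRr1// ltW.
set D := delta `^ (- s) in hw *.
have D0 : 0 <= D by exact: powR_ge0.
have -> : x * (eta * ln x / b) ^+ 2 * (b ^+ 2 * (D / (x * w ^+ 8)) * C) * w ^+ 4 =
    (eta * ln x) ^+ 2 * (C * D) / w ^+ 4.
  by field; rewrite !gt_eqF.
rewrite ler_pdivrMr ?exprn_gt0// mul1r.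
have CD0 : 0 <= C * D by exact: mulr_ge0.
apply: (@le_trans _ _ ((4 * w) ^+ 2 * (C * D))).
  have eL : 0 <= eta * ln x by apply: mulr_ge0 => //; exact: ltW.
  apply: ler_wpM2r => //; rewrite lerXn2r ?nnegrE ?(mulr_ge0 _ (ltW w0))//.
  have := ler_wpM2l (ltW eta0) Lw.
  by rewrite mulrA (mulrC eta (4 / eta)) divfK// gt_eqF.
have w1 : 1 <= w by lra.
have -> : (4 * w) ^+ 2 * (C * D) = w ^+ 2 * (16 * C * D) by ring.
have -> : w ^+ 4 = w ^+ 2 * w ^+ 2 by ring.
rewrite ler_wpM2l ?sqr_ge0//.
by nra.
Qed.

End truncation.

(** * Deviations of the sums *)

Section strong_law.
Context {d} {T : measurableType d} {R : realType} {P : probability T R}.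
Variables (U V : nat -> nat -> {RV P >-> R}).
Let X (ki : nat * nat) (t : T) : R * R := (U ki.1 ki.2 t, V ki.1 ki.2 t).
Hypothesis indX : mutually_independent_pairs P X.
Hypothesis idX : identically_distributed_pairs P X.

Local Notation Z := (fun t => U 0%N 0%N t * V 0%N 1%N t).

Let mZ : measurable_fun setT Z.
Proof. exact: measurable_cross. Qed.

Section deviation.
Variables (a s mu C : R).
Hypotheses (a0 : 0 < a) (s0 : 0 < s) (s2 : s <= 2) (as1 : 1 < a * s).
Hypotheses (C0 : 0 <= C) (ZC : (\int[P]_t (`|Z t| `^ s)%:E <= C%:E)%E).
Hypothesis muE : s <= 1 /\ mu = 0 \/
  1 <= s /\ mu%:E = (\int[P]_t (Z t)%:E)%E.

Let mZs : measurable_fun setT (fun t => `|Z t| `^ s).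
Proof.
apply: measurableT_comp (measurable_powR s) _; exact: measurableT_comp.
Qed.

Lemma integral_le_powR (W : T -> R) c : measurable_fun setT W -> 0 <= c ->
  (forall t, W t <= c * `|Z t| `^ s) -> (forall t, 0 <= W t) ->
  (\int[P]_t (W t)%:E <= (c * C)%:E)%E.
Proof.
move=> mW c0 Wc W0; apply: (@le_trans _ _ (\int[P]_t (c%:E * (`|Z t| `^ s)%:E))%E).
  apply: ge0_le_integral => //.
  - by move=> t _; rewrite lee_fin.
  - exact/measurable_EFinP.
  - by apply: measurable_funeM; exact/measurable_EFinP.
  - by move=> t _; rewrite -EFinM lee_fin.
rewrite ge0_integralZl//.
- by rewrite EFinM; apply: lee_wpmul2l.
- exact/measurable_EFinP.
Qed.

Lemma integrable_dominated_powR (W : T -> R) c : measurable_fun setT W -> 0 <= c ->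
  (forall t, `|W t| <= c * `|Z t| `^ s) ->
  P.-integrable setT (EFin \o W) /\ `|fine (\int[P]_t (W t)%:E)| <= c * C.
Proof.
move=> mW c0 Wc.
have WC : (\int[P]_t `|(W t)%:E| <= (c * C)%:E)%E.
  apply: (@integral_le_powR (fun t => `|W t|)) => //.
  exact: measurableT_comp.
have iW : P.-integrable setT (EFin \o W).
  apply/integrableP; split; first exact/measurable_EFinP.
  by apply: le_lt_trans WC _; exact: ltry.
split => //; rewrite -lee_fin -[X in (X <= _)%E]/(`|(fine (\int[P]_t (W t)%:E))%:E|)%E.
rewrite fineK; last exact: (integrable_fin_num measurableT iW).
by apply: le_trans WC; apply: le_abse_integral => //; exact/measurable_EFinP.
Qed.

(** In the case [s <= 1] the truncated mean itself is small, by [trunc_moment] with exponent 1; in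
    the case [s >= 1] it differs from [E Z] by the discarded tail, bounded by [trunc_tail]. *)
Lemma mean_trunc b : 0 < b -> exists m,
  (\int[P]_t (trunc b (Z t))%:E)%E = m%:E /\ `|m - mu| <= b `^ (1 - s) * C.
Proof.
move=> b0; exists (fine (\int[P]_t (trunc b (Z t))%:E)%E).
have mtZ : measurable_fun setT (fun t => trunc b (Z t)).
  exact: measurableT_comp (measurable_trunc b) mZ.
have itZ : P.-integrable setT (EFin \o (fun t => trunc b (Z t))).
  apply: (le_integrable _ _ _ (finite_measure_integrable_cst P b measurableT)) => //.
    exact/measurable_EFinP.
  by move=> t _; rewrite /= lee_fin (le_trans (trunc_le _ (ltW b0)))// ler_norm.
have fmtZ := integrable_fin_num measurableT itZ.
split; first by rewrite fineK.
have bs0 : 0 <= b `^ (1 - s) by exact: powR_ge0.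
case: muE => [[s1 ->]|[s1 mu1]].
  rewrite subr0; apply: (integrable_dominated_powR mtZ bs0 _).2 => t.
  have := trunc_moment (Z t) b0 ltr01 s1.
  by rewrite powRr1.
have mW : measurable_fun setT (fun t => trunc b (Z t) - Z t).
  exact: measurable_funB.
have [iW] := integrable_dominated_powR mW bs0 (fun t => trunc_tail (Z t) b0 s1).
apply: le_trans; rewrite le_eqVlt; apply/orP; left; apply/eqP; congr (`|_|).
apply: EFin_inj; rewrite EFinB fineK// mu1 fineK; last first.
  exact: (integrable_fin_num measurableT iW).
(* [Z] is written as [trunc b Z] minus the difference [trunc b Z - Z], both integrable. *)
have := integralB_EFin measurableT itZ iW.
rewrite (eq_integral (fun t => (Z t)%:E)); last first.
  by move=> t _; rewrite -EFinB opprB addrC subrK.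
move=> ->; rewrite oppeB ?fin_num_adde_defl//; last first.
  rewrite fin_numN; exact: (integrable_fin_num measurableT iW).
by rewrite addeA subee// add0e.
Qed.

(** One [eps * n^a] is the Chernoff deviation around the truncated mean [m], the other bounds
    [n * |m - mu|]. *)
Lemma pr_deviation eps : 0 < eps -> exists delta : R, 0 < delta /\ exists N0,
  forall n i j, (N0 <= n)%N -> i != j ->
  pr P [set t | 2 * eps * n%:R `^ a <=
    `|\sum_(k < n) trunc (delta * n%:R `^ a) (U k i t * V k j t) - n%:R * mu|]
  <= 2 * expR (1 - 4 * ln n%:R).
Proof.
move=> eps0; have [delta [d0 [N0 hN0]]] := chernoff_parameters C0 as1 eps0.
exists delta; split => //; exists (maxn 1 N0) => n i j.
rewrite geq_max => /andP[n1 /hN0]/=; set b := delta * _ => -[hm [l [l0 hl]]] ij.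
have b0 : 0 < b by rewrite mulr_gt0// powR_gt0// ltr0n.
have [m [mE mmu]] := mean_trunc b0.
pose W k t := trunc b (U k i t * V k j t).
have mt := measurable_trunc b.
have mW k : measurable_fun setT (W k).
  exact: measurableT_comp mt (measurable_cross U V k i j).
have iC := independent_cross indX ij.
have iW : independent P W.
  move=> S B uS mB; apply: (iC S (fun k => trunc b @^-1` B k) uS) => k.
  by rewrite -[X in measurable X]setTI; exact: mt.
have law k := fun B mB => cross_law indX idX k (i := i) (j := j) (B := B) ij mB.
have Wm k : (\int[P]_t (W k t)%:E = m%:E)%E.
  rewrite -mE; apply: (eq_integral_law (f := trunc b)) => //.
  - exact: measurable_cross.
  - by move=> B mB; exact: law.
have mt2 : measurable_fun setT (fun z => trunc b z ^+ 2) by exact: measurable_funX.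
have Wv k : (\int[P]_t (W k t ^+ 2)%:E <= (b `^ (2 - s) * C)%:E)%E.
  rewrite (eq_integral_law (Z := Z) (f := fun z => trunc b z ^+ 2))//.
  - apply: integral_le_powR; rewrite ?powR_ge0//.
    + exact: measurableT_comp mt2 mZ.
    + move=> t; have := trunc_moment (Z t) b0 (ltr0n R 2) s2.
      by rewrite powR_mulrn// real_normK// num_real.
    + by move=> t; exact: sqr_ge0.
  - exact: measurable_cross.
  - by move=> B mB; exact: law.
have Wb k t : `|W k t| <= b by apply: trunc_le; exact: ltW.
have mS : measurable_fun setT (fun t => \sum_(k < n) W k t).
  by apply: measurable_sum => k; exact: mW.
have mD c x : measurable [set t | x <= `|\sum_(k < n) W k t - c|].
  apply: measurable_ge_set; apply: measurableT_comp; first exact: normr_measurable.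
  exact: measurable_funB.
apply: (@le_trans _ _ (pr P [set t | eps * n%:R `^ a <=
    `|\sum_(k < n) W k t - n%:R * m|])).
  apply: le_pr; [exact: mD|exact: mD|].
  move=> t /= h.
  have hmu : `|n%:R * m - n%:R * mu| <= eps * n%:R `^ a.
    rewrite -mulrBr normrM ger0_norm//; apply: le_trans hm.
    exact: ler_wpM2l.
  have := ler_distD (n%:R * m) (\sum_(k < n) W k t) (n%:R * mu).
  move: h; rewrite /W; lra.
rewrite -lee_fin -prE//.
apply: le_trans (chernoff_sum_norm n (eps * n%:R `^ a) mW iW Wb l0 Wm Wv) _.
by rewrite lee_fin ler_pM2l// ler_expR.
Qed.

(** At most [(K n)^2] pairs, each of probability at most [2 e n^-4], give a total of order [n^-2];
    the first Borel-Cantelli lemma applies. *)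
Lemma ae_trunc_deviation (p : nat -> nat) (K : nat) eps : 0 < eps ->
  (forall n, (0 < n)%N -> (p n <= K * n)%N) ->
  exists delta : R, 0 < delta /\ {ae P, forall t, exists N, forall n, (N <= n)%N ->
    forall i j, (i < p n)%N -> (j < p n)%N -> i != j ->
    `|\sum_(k < n) trunc (delta * n%:R `^ a) (U k i t * V k j t) - n%:R * mu| <
    2 * eps * n%:R `^ a}.
Proof.
move=> eps0 pK; have [delta [d0 [N0 hN0]]] := pr_deviation eps0.
exists delta; split => //.
pose D n i j t :=
  `|\sum_(k < n) trunc (delta * n%:R `^ a) (U k i t * V k j t) - n%:R * mu|.
have mD n i j : measurable_fun setT (D n i j).
  apply: measurableT_comp; first exact: normr_measurable.
  apply: measurable_funB => //; apply: measurable_sum => k.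
  exact: measurableT_comp (measurable_trunc _) (measurable_cross U V k i j).
pose G n := [set t | 2 * eps * n%:R `^ a <=
  \big[Num.max/0]_(i < p n) \big[Num.max/0]_(j < p n | i != j) D n i j t].
have mG n : measurable (G n).
  apply: measurable_ge_set; apply: measurable_bigmax => i.
  by apply: measurable_bigmax => j; exact: mD.
have na0 n : (0 < n)%N -> 0 < 2 * eps * n%:R `^ a.
  by move=> n0; rewrite !mulr_gt0// powR_gt0// ltr0n.
have GP n t : (0 < n)%N -> G n t <-> exists i j : nat,
    [/\ (i < p n)%N, (j < p n)%N, i != j & 2 * eps * n%:R `^ a <= D n i j t].
  move=> /na0 x0; split.
    move=> /bigmax_geP[|[i _]]; first by rewrite leNgt x0.
    move=> /bigmax_geP[|[j ij xij]]; first by rewrite leNgt x0.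
    by exists i, j.
  move=> [i [j [im jm ij xij]]]; apply/bigmax_geP; right.
  exists (Ordinal im) => //; apply/bigmax_geP; right.
  by exists (Ordinal jm).
have prG n : (maxn 1 N0 <= n)%N ->
    pr P (G n) <= (2 * expR 1 * K%:R ^+ 2) * (n%:R ^+ 2)^-1.
  rewrite geq_max => /andP[n1 nN0].
  pose B (b : nat * nat) := if b.1 != b.2 then
    [set t | 2 * eps * n%:R `^ a <= D n b.1 b.2 t] else set0.
  have mB b : measurable (B b).
    by rewrite /B; case: ifP => _ //; apply: measurable_ge_set; exact: mD.
  pose q := [seq (b1, b2) | b1 <- iota 0 (p n), b2 <- iota 0 (p n)].
  apply: (@le_trans _ _ (\sum_(b <- q) pr P (B b))).
    apply: union_bound => // t /(GP n t n1)[i [j [ip jp ij Dij]]].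
    exists (i, j); first by apply/allpairsP; exists (i, j); rewrite !mem_iota.
    by rewrite /B/= ij.
  apply: (@le_trans _ _ (\sum_(b <- q) 2 * expR (1 - 4 * ln n%:R))).
    apply: ler_sum => -[i j] _; rewrite /B/=; case: ifPn => ij; first exact: hN0.
    by rewrite /pr measure0 mulr_ge0// expR_ge0.
  rewrite big_const_seq count_predT size_allpairs !size_iota iter_addr_0.
  have n0 : 0 < n%:R :> R by rewrite ltr0n.
  have -> : expR (1 - 4 * ln n%:R) = expR 1 / n%:R ^+ 4 :> R.
    by rewrite expRD expRN expRM_natl lnK// posrE.
  rewrite -[leLHS]mulr_natr natrM.
  apply: (@le_trans _ _ (2 * (expR 1 / n%:R ^+ 4) * ((K * n)%:R * (K * n)%:R))).
    apply: ler_wpM2l; first by rewrite mulr_ge0// divr_ge0// expR_ge0.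
    by rewrite ler_pM// ler_nat pK.
  rewrite natrM le_eqVlt; apply/orP; left; apply/eqP.
  by field; rewrite gt_eqF.
have bsG : bounded_sums (fun n => pr P (G n)).
  apply: bounded_sums_eventually_le prG bounded_sums_inv_sq.
    by move=> n; rewrite invr_ge0 sqr_ge0.
  by rewrite !mulr_ge0// ?expR_ge0 ?sqr_ge0.
case: bsG => B bB; have := ae_eventually_not mG bB.
apply: filterS => t [N hN]; exists (maxn 1 N) => n.
rewrite geq_max => /andP[n1 nN] i j ip jp ij; rewrite ltNge; apply/negP => h.
by apply: (hN n nN); apply/GP => //; exists i, j.
Qed.

End deviation.

Lemma ae_rowmax_small (a delta : R) (K : nat) : 0 < a -> 0 < delta ->
  bounded_sums (fun n => rowmax_tail U V n (n%:R `^ a)) ->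
  {ae P, forall t, exists M, forall m, (M <= m)%N -> forall k, (k < 2 ^ m.+1)%N ->
    rowmax (K * 2 ^ m.+1) (fun c => X (k, c) t) < delta * (2 ^ m)%:R `^ a}.
Proof.
move=> a0 d0 [B qB].
have [r0 hr0] := natr_powR_ge delta^-1 a0.
(* A shift of the dyadic index by [r] absorbs [delta]: with [m' = m + r + 2], the level
   [delta * (2^m')^a] is at least [n^a] for every [n < 2^(m+2)]. *)
have [r hr] : exists r, 1 <= delta * (2 ^ r)%:R `^ a.
  exists r0; have := hr0 (2 ^ r0)%N (ltnW (ltn_expl r0 (ltnSn 1))).
  by rewrite -[1](mulfV (negbT (gt_eqF d0))) ler_pM2l.
pose A m := [set t | delta * (2 ^ m)%:R `^ a <= \big[Num.max/0]_(k < 2 ^ m.+1)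
  rowmax (K * 2 ^ m.+1) (fun c => X (nat_of_ord k, c) t)].
have mA m : measurable (A m).
  apply: measurable_ge_set; apply: measurable_bigmax => k.
  exact: (measurable_rowmax_array U V _ (pair (nat_of_ord k))).
have y0 m : 0 < delta * (2 ^ m)%:R `^ a.
  by rewrite mulr_gt0// powR_gt0// ltr0n expn_gt0.
(* [a'] blocks of [2^m] columns make up the [K * 2^(m'+1)] columns, and two such blocks fit in a row
   of [n >= 2^(m+1)] columns. *)
pose a' := (K * 2 ^ r.+3)%N.
pose blk m := \sum_((2 ^ m.+1)%N <= n < (2 ^ m.+2)%N) rowmax_tail U V n (n%:R `^ a).
have prA m : pr P (A (m + r.+2)%N) <= ((2 ^ r.+2 * a' ^ 2)%:R) * blk m.
  set m' := (m + r.+2)%N; set y := delta * (2 ^ m')%:R `^ a.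
  have Qy n : (2 ^ m.+1 <= n < 2 ^ m.+2)%N ->
      rowmax_tail U V (K * 2 ^ m'.+1) y <= (a' ^ 2)%:R * rowmax_tail U V n (n%:R `^ a).
    move=> /andP[n1 n2]; have n0 : (0 < n)%N by apply: leq_trans n1; rewrite expn_gt0.
    have na0 : 0 < n%:R `^ a :> R by rewrite powR_gt0// ltr0n.
    apply: (@le_trans _ _ (rowmax_tail U V (K * 2 ^ m'.+1) (n%:R `^ a))).
      apply: le_pr.
      - exact: (measurable_row_ge U V _ _ (pair 0%N)).
      - exact: (measurable_row_ge U V _ _ (pair 0%N)).
      - move=> t /=; apply: le_trans.
        rewrite /y /m' addnS -addSn addnS -addSn expnD natrM powRM// mulrCA.
        rewrite -[leLHS]mulr1 ler_pM// ?powR_ge0//.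
        by rewrite ge0_ler_powR ?nnegrE ?(ltW a0)// ler_nat ltnW.
    apply: (rowmax_tail_scale indX idX (h := 2 ^ m)) => //.
      by rewrite /a' -mulnA -expnD leq_mul2l leq_exp2l// orbC /m'; lia.
    by rewrite -mul2n -expnS.
  set q := rowmax_tail U V _ y in Qy.
  (* The dyadic block holds [2^(m+1)] values of [n], each bounding [q]. The number of rows,
     [2^(m'+1)], is the constant [2^(r+2)] times this count. *)
  have key : (2 ^ m.+1)%:R * q <= (a' ^ 2)%:R * blk m.
    rewrite /blk mulr_sumr.
    apply: (@le_trans _ _ (\sum_((2 ^ m.+1)%N <= n < (2 ^ m.+2)%N) q)).
      have e : (2 ^ m.+2 - 2 ^ m.+1 = 2 ^ m.+1)%N by rewrite [(2 ^ m.+2)%N]expnS; lia.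
      by rewrite sumr_const_nat e mulr_natl.
    by rewrite big_nat [leRHS]big_nat; apply: ler_sum => n /Qy.
  apply: (@le_trans _ _ ((2 ^ m'.+1)%:R * q)).
    apply: (@le_trans _ _ (\sum_(k <- iota 0 (2 ^ m'.+1)) pr P
        [set t | y <= rowmax (K * 2 ^ m'.+1) (fun c => X (k, c) t)])).
      apply: union_bound => //.
        by move=> k; exact: (measurable_row_ge U V _ _ (pair k)).
      move=> t /bigmax_geP[|[k _ hk]]; first by rewrite leNgt y0.
      by exists (nat_of_ord k) => //; rewrite mem_iota add0n /=.
    rewrite (eq_bigr (fun=> q)); last first.
      by move=> k _; rewrite (pr_rowmax indX idX)// => ? ? [].
    by rewrite big_const_seq count_predT size_iota iter_addr_0 mulr_natl.
  have -> : (2 ^ m'.+1)%N = (2 ^ r.+2 * 2 ^ m.+1)%N by rewrite -expnD; congr expn; lia.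
  rewrite (natrM _ (2 ^ r.+2) (2 ^ m.+1)) (natrM _ (2 ^ r.+2) (a' ^ 2)) -!mulrA.
  exact: ler_wpM2l.
have blkE M : \sum_(0 <= m < M) blk m = \sum_(2 <= n < (2 ^ M.+1)%N) rowmax_tail U V n (n%:R `^ a).
  elim: M => [|M IH]; first by rewrite !big_geq.
  rewrite big_nat_recr//= IH /blk -big_cat_nat//=.
    by rewrite expnS -[X in (X <= _)%N](muln1 2) leq_mul2l expn_gt0.
  by rewrite leq_exp2l.
have sA M : \sum_(0 <= m < M) pr P (A (m + r.+2)%N) <= (2 ^ r.+2 * a' ^ 2)%:R * B.
  apply: (@le_trans _ _ (\sum_(0 <= m < M) (2 ^ r.+2 * a' ^ 2)%:R * blk m)).
    by apply: ler_sum => m _; exact: prA.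
  rewrite -mulr_sumr blkE ler_wpM2l//; apply: le_trans (qB (2 ^ M.+1)%N).
  rewrite [leRHS](big_cat_nat (n := 2))//= ?lerDr.
    by apply: sumr_ge0 => n _; exact: rowmax_tail_ge0.
  by rewrite -[X in (X <= _)%N](expn1 2) leq_exp2l.
have := ae_eventually_not (fun m => mA (m + r.+2)%N) sA.
apply: filterS => t [N hN]; exists (N + r.+2)%N => m Nm k km.
rewrite ltNge; apply/negP => h; apply: (hN (m - r.+2)%N); first by lia.
rewrite subnK; last by lia.
by apply/bigmax_geP; right; exists (Ordinal km).
Qed.

End strong_law.

(** * Strong law and its converse *)

Section product_mean.
Context {d} {T : measurableType d} {R : realType} (P : probability T R).

(** If [E|F|] or [E|G|] is 0, both sides vanish, with [0 * oo = 0]. Otherwise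
    [E|F| E|G| = E|F G| < oo] makes both factors integrable, and positive and negative parts reduce
    the claim to the nonnegative case. *)
Lemma integral_prod_independent (F G : T -> R) :
  measurable_fun setT F -> measurable_fun setT G -> independent2 P F G ->
  P.-integrable setT (EFin \o (fun t => F t * G t)) ->
  (\int[P]_t (F t)%:E * \int[P]_t (G t)%:E = \int[P]_t (F t * G t)%:E)%E.
Proof.
move=> mF mG iFG iZ.
have mabs : measurable_fun setT (fun x : R => `|x|) by exact: normr_measurable.
have absM : (\int[P]_t `|F t * G t|%:E =
    \int[P]_t `|F t|%:E * \int[P]_t `|G t|%:E)%E.
  under eq_integral do rewrite normrM.
  apply: ge0_integralM_independent => //; try exact: measurableT_comp.
  exact: (independent2_comp mabs mabs).
have absoo : (\int[P]_t `|F t|%:E * \int[P]_t `|G t|%:E < +oo)%E.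
  by rewrite -absM; case/integrableP : iZ.
have le0 (f : T -> R) : measurable_fun setT f -> (\int[P]_t `|f t|%:E = 0)%E ->
    (\int[P]_t (f t)%:E = 0)%E.
  move=> mf f0; apply/eqP; rewrite -abse_eq0 eq_le abse_ge0 andbT -f0.
  by apply: le_abse_integral => //; exact/measurable_EFinP.
have mFG : measurable_fun setT (fun t => F t * G t) by exact: measurable_funM.
have [F0|F0] := eqVneq (\int[P]_t `|F t|%:E)%E 0%E.
  by rewrite (le0 F)// mul0e (le0 _ mFG)// absM F0 mul0e.
have [G0|G0] := eqVneq (\int[P]_t `|G t|%:E)%E 0%E.
  by rewrite (le0 G)// mule0 (le0 _ mFG)// absM G0 mule0.
have Fge : (0 <= \int[P]_t `|F t|%:E)%E by exact: integral_ge0.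
have Gge : (0 <= \int[P]_t `|G t|%:E)%E by exact: integral_ge0.
have Foo : (\int[P]_t `|F t|%:E < +oo)%E.
  rewrite ltey; apply/eqP => Fy.
  have Gp : (0 < \int[P]_t `|G t|%:E)%E by rewrite lt0e G0.
  by rewrite Fy gt0_mulye in absoo.
have Goo : (\int[P]_t `|G t|%:E < +oo)%E.
  rewrite ltey; apply/eqP => Gy.
  have Fp : (0 < \int[P]_t `|F t|%:E)%E by rewrite lt0e F0.
  by rewrite Gy gt0_muley in absoo.
have intF : P.-integrable setT (EFin \o F).
  by apply/integrableP; split => //; exact/measurable_EFinP.
have intG : P.-integrable setT (EFin \o G).
  by apply/integrableP; split => //; exact/measurable_EFinP.
pose u (e : bool) (x : R) := Num.max (if e then x else - x) 0.
have mu e : measurable_fun setT (u e).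
  by apply: measurable_maxr => //; case: e => //; exact: measurableT_comp.
have u0 e x : 0 <= u e x by rewrite le_max lexx orbT.
have ule e x : u e x <= `|x|.
  rewrite ge_max normr_ge0 andbT; case: e; first exact: ler_norm.
  by rewrite -normrN ler_norm.
have uE x : x = u true x - u false x.
  rewrite /u; case: (leP 0 x) => x0.
    by rewrite (max_idPr _) ?subr0// oppr_le0.
  by rewrite (max_idPl _) ?sub0r ?opprK// oppr_ge0 ltW.
have iu (f : T -> R) e : measurable_fun setT f -> P.-integrable setT (EFin \o f) ->
    P.-integrable setT (EFin \o (fun t => u e (f t))).
  move=> mf; apply: le_integrable => //.
    by apply/measurable_EFinP; exact: measurableT_comp (mu e) mf.
  by move=> t _; rewrite /= lee_fin ger0_norm.
pose a e := fine (\int[P]_t (u e (F t))%:E)%E.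
pose b e := fine (\int[P]_t (u e (G t))%:E)%E.
have aE e : (\int[P]_t (u e (F t))%:E = (a e)%:E)%E.
  by rewrite fineK//; exact: (integrable_fin_num measurableT (iu F e mF intF)).
have bE e : (\int[P]_t (u e (G t))%:E = (b e)%:E)%E.
  by rewrite fineK//; exact: (integrable_fin_num measurableT (iu G e mG intG)).
have splitE (f : T -> R) : measurable_fun setT f -> P.-integrable setT (EFin \o f) ->
    (\int[P]_t (f t)%:E =
     \int[P]_t (u true (f t))%:E - \int[P]_t (u false (f t))%:E)%E.
  move=> mf intf; rewrite -(integralB_EFin measurableT (iu f true mf intf) (iu f false mf intf)).
  by apply: eq_integral => t _; rewrite -EFinB -uE.
pose w e e' t := u e (F t) * u e' (G t).
have mw e e' : measurable_fun setT (w e e').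
  by apply: measurable_funM; [exact: measurableT_comp (mu e) mF|
    exact: measurableT_comp (mu e') mG].
have wE e e' : (\int[P]_t (w e e' t)%:E = (a e * b e')%:E)%E.
  rewrite EFinM -aE -bE; apply: ge0_integralM_independent => //.
  - exact: measurableT_comp (mu e) mF.
  - exact: measurableT_comp (mu e') mG.
  - exact: independent2_comp.
have iw e e' : P.-integrable setT (EFin \o w e e').
  apply: le_integrable iZ => //; first exact/measurable_EFinP.
  move=> t _; rewrite /= lee_fin ger0_norm ?mulr_ge0// normrM.
  by rewrite ler_pM.
rewrite (splitE F)// (splitE G)// !aE !bE -!EFinB -EFinM.
transitivity (\int[P]_t ((w true true t + w false false t)%:E -
    (w true false t + w false true t)%:E))%E; last first.
  apply: eq_integral => t _; rewrite -EFinB; congr EFin.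
  by rewrite [in RHS](uE (F t)) [in RHS](uE (G t)) /w; ring.
have iD e1 e2 e3 e4 :
    P.-integrable setT (EFin \o (fun t => w e1 e2 t + w e3 e4 t)).
  exact: (integrableD measurableT (iw e1 e2) (iw e3 e4)).
have ED e1 e2 e3 e4 : (\int[P]_t (w e1 e2 t + w e3 e4 t)%:E =
    (a e1 * b e2 + a e3 * b e4)%:E)%E.
  rewrite EFinD -!wE -(integralD_EFin measurableT (iw e1 e2) (iw e3 e4)).
  exact: eq_integral.
rewrite (integralB_EFin measurableT (iD _ _ _ _) (iD _ _ _ _)) !ED -EFinB.
by congr EFin; ring.
Qed.

End product_mean.

(** * Deviations of the untruncated sums, and necessity of the series condition *)

Section strong_law_array.
Context {d} {T : measurableType d} {R : realType} {P : probability T R}.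
Variables (U V : nat -> nat -> {RV P >-> R}).
Let X (ki : nat * nat) (t : T) : R * R := (U ki.1 ki.2 t, V ki.1 ki.2 t).
Hypothesis indX : mutually_independent_pairs P X.
Hypothesis idX : identically_distributed_pairs P X.

Local Notation Z := (fun t => U 0%N 0%N t * V 0%N 1%N t).

Let mZ : measurable_fun setT Z.
Proof. exact: measurable_cross. Qed.

Lemma integrable_cross (s : R) : 1 <= s ->
  (\int[P]_t (`|Z t| `^ s)%:E < +oo)%E -> P.-integrable setT (EFin \o Z).
Proof.
move=> s1 Zs.
have mZs : measurable_fun setT (fun t => `|Z t| `^ s).
  by apply: measurableT_comp (measurable_powR s) _; exact: measurableT_comp.
have iZs : P.-integrable setT (EFin \o (fun t => `|Z t| `^ s)).
  apply/integrableP; split; first exact/measurable_EFinP.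
  by under eq_integral do rewrite /= ger0_norm ?powR_ge0//.
have i1 := finite_measure_integrable_cst P 1 measurableT.
apply: (le_integrable _ _ _ (integrableD measurableT i1 iZs)) => //.
  exact/measurable_EFinP.
move=> t _; rewrite /= lee_fin [leRHS]ger0_norm ?addr_ge0 ?powR_ge0//.
have [z1|z1] := leP `|Z t| 1; first by apply: ler_wpDr => //; exact: powR_ge0.
apply: ler_wpDl => //; rewrite -[leLHS]powRr1//.
by rewrite ler_powR// ltW.
Qed.

(** For [a > 1] the mean of [Z] may fail to exist, and no centring is made at the scale [n^a]. *)
Definition centering (a : R) : R :=
  if a <= 1 then fine (\int[P]_t (Z t)%:E)%E else 0.

Lemma integrable_cross_le1 (a : R) : 0 < a -> a <= 1 ->
  bounded_sums (fun n => rowmax_tail U V n (n%:R `^ a)) -> P.-integrable setT (EFin \o Z).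
Proof.
move=> a0 a1 bs; apply: (@integrable_cross 2); first by lra.
apply: (integral_powR_lty_tail mZ a0 _ _ (bounded_sums_tail indX idX a0 bs)) => //.
by lra.
Qed.

Lemma ae_max_deviation (a : R) (p : nat -> nat) (K : nat) (eps : R) :
  1 / 2 < a -> 0 < eps -> (forall n, (0 < n)%N -> (p n <= K * n)%N) ->
  bounded_sums (fun n => rowmax_tail U V n (n%:R `^ a)) ->
  {ae P, forall t, exists N, forall n, (N <= n)%N ->
    forall i j, (i < p n)%N -> (j < p n)%N -> i != j ->
    `|\sum_(k < n) U k i t * V k j t - n%:R * centering a| <
    2 * eps * n%:R `^ a}.
Proof.
move=> a12 eps0 pK bs; have a0 : 0 < a by lra.
have bt := bounded_sums_tail indX idX a0 bs.
have [s [s0 s2 as1 as2 muE]] : exists s : R, [/\ 0 < s, s <= 2, 1 < a * s,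
    a * s <= 2 & (s <= 1 /\ centering a = 0 \/
      1 <= s /\ (centering a)%:E = (\int[P]_t (Z t)%:E)%E)].
  rewrite /centering; have [a1|a1] := leP a 1.
    exists 2; split => //; [lra|lra|right; split; first by lra].
    rewrite fineK//; apply: (integrable_fin_num measurableT).
    exact: (integrable_cross_le1 a0).
  exists (Num.min 1 (2 / a)).
  have [h|h] := leP 1 (2 / a).
    by split => //; [lra|lra|move: h; rewrite ler_pdivlMr// mul1r mulr1|left].
  have e : a * (2 / a) = 2 by field; rewrite gt_eqF.
  by split; rewrite ?e; [rewrite divr_gt0|lra|lra|lra|left; split => //; exact: ltW].
have Zs := integral_powR_lty_tail mZ a0 s0 as2 bt.
pose C := fine (\int[P]_t (`|Z t| `^ s)%:E)%E.
have Zs0 : (0 <= \int[P]_t (`|Z t| `^ s)%:E)%E.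
  by apply: integral_ge0 => t _; rewrite lee_fin powR_ge0.
have CE : (\int[P]_t (`|Z t| `^ s)%:E <= C%:E)%E.
  by rewrite fineK// ge0_fin_numE.
have C0 : 0 <= C by exact: fine_ge0.
have [delta [d0 dev]] := ae_trunc_deviation indX idX s2 as1 C0 CE muE eps0 pK.
have small := ae_rowmax_small indX idX K a0 d0 bs.
apply: filterS2 dev small => t [N hN] [M hM].
exists (maxn 1 (maxn N (2 ^ M))) => n; rewrite !geq_max => /and3P[n1 nN nM] i j ip jp ij.
pose m := trunc_log 2 n.
have Mm : (M <= m)%N by exact: trunc_log_max.
have n2 : (n < 2 ^ m.+1)%N by exact: trunc_log_ltn.
have n3 : (2 ^ m <= n)%N by exact: trunc_logP.
have pn : (p n <= K * 2 ^ m.+1)%N.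
  by apply: (leq_trans (pK n n1)); rewrite leq_mul2l (ltnW n2) orbT.
have := hN n nN i j ip jp ij.
(* The truncation is void: with [2^m <= n < 2^(m+1)], row [k] and columns [i], [j] fall within the
   range of the dyadic bound, and [delta * (2^m)^a <= delta * n^a]. *)
rewrite (eq_bigr (fun k : 'I_n => U k i t * V k j t))// => k _.
rewrite /trunc ifT//.
have kn : (k < 2 ^ m.+1)%N by apply: ltn_trans n2.
have y0 : 0 < delta * (2 ^ m)%:R `^ a.
  by rewrite mulr_gt0// powR_gt0// ltr0n expn_gt0.
apply: (@le_trans _ _ (delta * (2 ^ m)%:R `^ a)); last first.
  by apply: ler_wpM2l; rewrite ?ge0_ler_powR ?nnegrE ?ler_nat ?(ltW a0) ?(ltW d0).
rewrite leNgt; apply/negP => h.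
have := hM m Mm k kn; rewrite ltNge => /negP; apply.
apply/rowmaxP => //; exists i, j; split => //; last exact: ltW.
  exact: (leq_trans ip).
exact: (leq_trans jp).
Qed.

Lemma le_Tstat (p n : nat) t (i j : nat) : (i < p)%N -> (j < p)%N -> i != j ->
  `|\sum_(k < n) U k i t * V k j t| <=
  Tstat (fun k i => U k i : T -> R) (fun k i => V k i : T -> R) p n t.
Proof.
move=> ip jp ij; rewrite /Tstat.
pose F (i j : nat) := `|\sum_(k < n) U k i t * V k j t|.
apply: (@le_trans _ _ (\big[Num.max/0]_(j < p | Ordinal ip != j) F i j)).
  exact: (le_bigmax_cond 0 (j := Ordinal jp) (fun j : 'I_p => F i j)).
exact: (le_bigmax 0
  (fun i : 'I_p => \big[Num.max/0]_(j < p | i != j) F i j) (Ordinal ip)).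
Qed.

Lemma Tstat_ge0 (p n : nat) t :
  0 <= Tstat (fun k i => U k i : T -> R) (fun k i => V k i : T -> R) p n t.
Proof. exact: bigmax_ge_id. Qed.

Lemma Tstat_cvg0_lt (p : nat -> nat) (a eps : R) t : 0 < eps ->
  (fun n : nat => Tstat (fun k i => U k i : T -> R) (fun k i => V k i : T -> R)
     (p n) n t / (n%:R `^ a)) @ \oo --> (0 : R) ->
  exists N, forall n, (N <= n)%N ->
  Tstat (fun k i => U k i : T -> R) (fun k i => V k i : T -> R) (p n) n t <
  eps * n%:R `^ a.
Proof.
move=> eps0 /cvgrPdist_lt/(_ eps eps0)[N _ hN]; exists (maxn 1 N) => n.
rewrite geq_max => /andP[n1 nN]; have := hN n nN.
have na0 : 0 < n%:R `^ a :> R by rewrite powR_gt0// ltr0n.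
rewrite /= sub0r normrN ger0_norm ?ltr_pdivrMr//.
by rewrite divr_ge0 ?Tstat_ge0// ltW.
Qed.

Lemma Tstat_cvg0_bounded_sums (p : nat -> nat) (a : R) (c : nat) : 0 < a ->
  (forall n, (0 < n)%N -> (n <= c * p n)%N) ->
  {ae P, forall t,
    (fun n : nat => Tstat (fun k i => U k i : T -> R) (fun k i => V k i : T -> R)
                      (p n) n t / (n%:R `^ a)) @ \oo --> (0 : R)} ->
  bounded_sums (fun n => rowmax_tail U V n (n%:R `^ a)).
Proof.
move=> a0 cp aeT; pose q n := minn (p n) (p n.+1).
have aeR : {ae P, forall t, exists N, forall n, (N <= n)%N ->
    rowmax (q n) (fun c => X (n, c) t) < n%:R `^ a}.
  (* [A] is chosen so that the bounds [n^a / A] and [(n+1)^a / A <= 2^a n^a / A] on two consecutive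
     sums add up to at most [n^a]. *)
  apply: filterS aeT => t Tt; set A := 1 + 2 `^ a : R.
  have A1 : 1 <= A by rewrite lerDl powR_ge0.
  have [N hN] := Tstat_cvg0_lt (eps := A^-1) ltac:(rewrite invr_gt0; lra) Tt.
  exists (maxn 1 N) => n; rewrite geq_max => /andP[n1 nN].
  have na0 : 0 < n%:R `^ a :> R by rewrite powR_gt0// ltr0n.
  rewrite ltNge; apply/negP => /(rowmaxP _ _ na0)[i [j [iq jq ij]]] /=.
  move: iq jq; rewrite !ltn_min => /andP[i1 i2] /andP[j1 j2].
  have h1 := le_Tstat n t i1 j1 ij.
  have h2 := le_Tstat n.+1 t i2 j2 ij.
  have h3 := hN n nN; have h4 := hN n.+1 (leqW nN).
  rewrite big_ord_recr/= in h2.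
  have h5 : n.+1%:R `^ a <= 2 `^ a * n%:R `^ a :> R.
    rewrite -powRM// ge0_ler_powR ?nnegrE ?(ltW a0)//.
    by rewrite -natrM ler_nat; lia.
  have h6 : A^-1 * n.+1%:R `^ a <= A^-1 * (2 `^ a * n%:R `^ a).
    by rewrite ler_wpM2l// invr_ge0; lra.
  have h7 : A^-1 * n%:R `^ a + A^-1 * (2 `^ a * n%:R `^ a) = n%:R `^ a.
    have -> : A^-1 * n%:R `^ a + A^-1 * (2 `^ a * n%:R `^ a) = A^-1 * A * n%:R `^ a.
      by rewrite /A; ring.
    by rewrite mulVf ?mul1r// gt_eqF//; lra.
  (* Rows are counted from 0, so row [n] gives the last summand [x] of the sum with [n + 1]
     terms. *)
  set S := \sum_(k < n) _ in h1 h2; set x := _ * _ in h2 *.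
  have := ler_normB (S + x) S; rewrite addrAC subrr add0r.
  lra.
have mrow n : measurable_fun setT (fun t => rowmax (q n) (fun c => X (n, c) t)).
  exact: (measurable_rowmax_array U V (q n) (pair n)).
have := ae_eventually_not_summable mrow (independent_rows indX q) aeR.
move=> bs; have {bs} : bounded_sums (fun n => rowmax_tail U V (q n) (n%:R `^ a)).
  case: bs => B bB; exists B => N; apply: le_trans (bB N).
  rewrite le_eqVlt; apply/orP; left; apply/eqP; apply: eq_bigr => n _.
  by rewrite -(pr_rowmax indX idX (q n) (n%:R `^ a) (s := pair n))// => ? ? [].
(* From [n > c] and [n <= c * q n] follows [q n >= 2], hence [q n <= 3 * (q n)./2]: the [n] columns
   are covered by [3 c] blocks of [(q n)./2] columns. *)
apply: (bounded_sums_eventually_le (c := ((3 * c) ^ 2)%:R) (N0 := c.+1)) => //.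
  by move=> n; exact: rowmax_tail_ge0.
move=> n cn; have n1 : (0 < n)%N by lia.
have na0 : 0 < n%:R `^ a :> R by rewrite powR_gt0// ltr0n.
have nq : (n <= c * q n)%N.
  rewrite /q; case: (leqP (p n) (p n.+1)) => _; first exact: cp.
  by apply: leq_trans (cp n.+1 isT).
have q2 : (2 <= q n)%N.
  rewrite ltnNge; apply/negP => q1.
  have : (c * q n <= c * 1)%N by rewrite leq_mul2l q1 orbT.
  by lia.
apply: (rowmax_tail_scale indX idX (h := (q n)./2)) => //; last by lia.
apply: (leq_trans nq); rewrite -mulnA mulnCA leq_mul2l.
by apply/orP; right; lia.
Qed.

End strong_law_array.

(** * The equivalence *)

Unset Implicit Arguments.

Theorem theorem3p2 (d : measure_display) (T : measurableType d) (R : realType)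
  (P : probability T R) (U V : nat -> nat -> {RV P >-> R}) (p : nat -> nat)
  (alpha : R) :
  mutually_independent_pairs P
    (fun ki : nat * nat => fun t => (U ki.1 ki.2 t, V ki.1 ki.2 t)) ->
  identically_distributed_pairs P
    (fun ki : nat * nat => fun t => (U ki.1 ki.2 t, V ki.1 ki.2 t)) ->
  (forall n, (0 < n)%N -> (0 < p n)%N) ->
  (exists c1 c2 : R, 0 < c1 /\ 0 < c2 /\
     forall n, (0 < n)%N -> c1 <= n%:R / (p n)%:R <= c2) ->
  1 / 2 < alpha ->
  ({ae P, forall t,
      (fun n : nat => Tstat (fun k i => U k i : T -> R) (fun k i => V k i : T -> R)
                        (p n) n t / (n%:R `^ alpha)) @ \oo --> (0 : R)}
   <->
   ((\sum_(1 <= n <oo)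
       P [set t | (n%:R `^ alpha <= Mstat (fun k i => U k i : T -> R)
                                     (fun k i => V k i : T -> R) n t)%R] < +oo)%E
    /\ (alpha <= 1 -> ('E_P[U 0%N 0%N] * 'E_P[V 0%N 0%N])%E = 0%E))).
Proof.
move=> indX idX p0 [c1 [c2 [c10 [c20 pc]]]] a12.
have a0 : 0 < alpha by lra.
have [K pK] : exists K, forall n, (0 < n)%N -> (p n <= K * n)%N.
  exists (Num.truncn c1^-1).+1 => n n0; have pn0 : 0 < (p n)%:R :> R by rewrite ltr0n p0.
  have /andP[+ _] := pc n n0; rewrite ler_pdivlMr// mulrC -ler_pdivlMr// => h.
  rewrite -(ler_nat R) natrM; apply: (le_trans h); rewrite mulrC.
  by apply: ler_wpM2r => //; apply/ltW/truncnS_gt.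
have [c cp] : exists c, forall n, (0 < n)%N -> (n <= c * p n)%N.
  exists (Num.truncn c2).+1 => n n0; have pn0 : 0 < (p n)%:R :> R by rewrite ltr0n p0.
  have /andP[_] := pc n n0; rewrite ler_pdivrMr// => h.
  rewrite -(ler_nat R) natrM; apply: (le_trans h).
  by apply: ler_wpM2r => //; apply/ltW/truncnS_gt.
have series : (\sum_(1 <= n <oo)
       P [set t | (n%:R `^ alpha <= Mstat (fun k i => U k i : T -> R)
                                     (fun k i => V k i : T -> R) n t)%R] < +oo)%E <->
    bounded_sums (fun n => rowmax_tail U V n (n%:R `^ alpha)).
  rewrite (eq_eseriesr (g := fun n => (rowmax_tail U V n (n%:R `^ alpha))%:E)); last first.
    by move=> n _; rewrite -prE//; exact: (measurable_row_ge U V n _ (pair 0%N)).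
  apply: iff_trans (bounded_sums_from1 (fun n => rowmax_tail_ge0 U V n (n%:R `^ alpha))).
  exact: (eseries_lty_bounded 1 (fun n => rowmax_tail_ge0 U V n (n%:R `^ alpha))).
have mean : alpha <= 1 -> bounded_sums (fun n => rowmax_tail U V n (n%:R `^ alpha)) ->
    ('E_P[U 0%N 0%N] * 'E_P[V 0%N 0%N])%E = (centering U V alpha)%:E.
  move=> a1 bs; rewrite unlock /centering a1.
  have iZ := integrable_cross_le1 indX idX a0 a1 bs.
  (* [U] and [V] of the same column may be dependent; identical distribution moves [V] to the next
     column, where it is independent of [U 0 0]. *)
  have -> : (\int[P]_t (V 0%N 0%N t)%:E = \int[P]_t (V 0%N 1%N t)%:E)%E.
    apply: (eq_integral_law (f := id)) => // B mB.
    have := idX (0%N, 0%N) (0%N, 1%N) (snd @^-1` B); apply.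
    by rewrite -[X in measurable X]setTI; exact: measurable_snd.
  rewrite (integral_prod_independent _ _ (independent2_UV indX) iZ)//.
  by rewrite fineK//; exact: (integrable_fin_num measurableT iZ).
have dev := ae_max_deviation indX idX a12 _ pK.
split.
  move=> aeT; have bs := Tstat_cvg0_bounded_sums indX idX a0 cp aeT.
  split; first exact/series.
  move=> a1; rewrite mean//; congr EFin; apply/eqP/negPn/negP => mu0.
  set mu := centering U V alpha in mu0 *.
  (* With [eps = |mu| / 6], the bounds [eps * n^alpha] on [|S|] and [2 * eps * n^alpha] on
     [|S - n mu|] add up to at most [n |mu| / 2], a contradiction. *)
  have e0 : 0 < `|mu| / 6 by rewrite divr_gt0 ?normr_gt0.
  have [t [Tt [N hN]]] := ae_exists (filterI aeT (dev _ e0 bs)).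
  have [N' hN'] := Tstat_cvg0_lt e0 Tt.
  (* Taking [n] beyond [c + c] forces [p n >= 2], so that the pair of columns 0 and 1 is
     available. *)
  have [n [nN nN' nc]] : exists n, [/\ (N <= n)%N, (N' <= n)%N & (c + c < n)%N].
    exists (maxn (maxn N N') (c + c).+1).
    by rewrite !leq_max !leqnn ?orbT.
  have n0 : (0 < n)%N by lia.
  have p2 : (1 < p n)%N.
    rewrite ltnNge; apply/negP => p1; have := cp n n0.
    have : (c * p n <= c * 1)%N by rewrite leq_mul2l p1 orbT.
    by lia.
  have h1 := hN n nN 0%N 1%N (ltnW p2) p2 isT.
  have h2 := le_lt_trans (le_Tstat U V n t (ltnW p2) p2 isT) (hN' n nN').
  rewrite -/mu in h1; set S := \sum_(k < n) _ in h1 h2.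
  have n0R : 0 < n%:R :> R by rewrite ltr0n.
  have h3 : n%:R `^ alpha <= n%:R :> R by apply: ler1_powR => //; rewrite ler1n.
  have h4 : n%:R * `|mu| <= `|S| + `|S - n%:R * mu|.
    rewrite -{1}(ger0_norm (ltW n0R)) -normrM.
    have := ler_normB S (S - n%:R * mu).
    by rewrite opprB addrC subrK.
  have h5 : `|mu| / 6 * n%:R `^ alpha <= `|mu| / 6 * n%:R by rewrite ler_pM2l.
  have h6 : 0 < n%:R * `|mu| by rewrite mulr_gt0 ?normr_gt0.
  lra.
move=> [/series bs EUV].
have mu0 : centering U V alpha = 0.
  have [a1|a1] := leP alpha 1; last by rewrite /centering leNgt a1.
  by apply: EFin_inj; rewrite -mean// EUV.
(* The tolerance runs through [1 / (r + 1)], so that only countably many null sets are discarded. *)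
have ae_all : {ae P, forall t, forall r : nat, exists N, forall n, (N <= n)%N ->
    forall i j, (i < p n)%N -> (j < p n)%N -> i != j ->
    `|\sum_(k < n) U k i t * V k j t| < 2 * r.+1%:R^-1 * n%:R `^ alpha}.
  apply: ae_foralln => r.
  have r0 : 0 < r.+1%:R^-1 :> R by rewrite invr_gt0.
  apply: filterS (dev _ r0 bs) => t [N hN]; exists N => n nN i j ip jp ij.
  by have := hN n nN i j ip jp ij; rewrite mu0 mulr0 subr0.
apply: filterS ae_all => t ht; apply/cvgrPdist_le => eps eps0.
pose r := Num.truncn (2 / eps).
have [N hN] := ht r.
exists (maxn 1 N) => // n nmax; have : (maxn 1 N <= n)%N := nmax.
rewrite geq_max => /andP[n1 nN]; rewrite /=.
have na0 : 0 < n%:R `^ alpha :> R by rewrite powR_gt0// ltr0n.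
rewrite sub0r normrN ger0_norm; last by rewrite divr_ge0 ?Tstat_ge0// ltW.
rewrite ler_pdivrMr//.
have re : 2 * r.+1%:R^-1 <= eps.
  rewrite ler_pdivrMr// mulrC -ler_pdivrMr//.
  exact/ltW/truncnS_gt.
have en0 : 0 <= eps * n%:R `^ alpha by rewrite mulr_ge0// ltW.
rewrite /Tstat; apply: bigmax_le => // i _; apply: bigmax_le => // j ij.
apply: (le_trans (ltW (hN n nN i j (ltn_ord i) (ltn_ord j) ij))).
by rewrite ler_wpM2r// ltW.
Qed.
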